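(* Let $\kappa$ be an integrable kernel on a type space $(\mathcal S,\mu)$ with $\mu(\mathcal S)=1$. (i) If $\kappa$ is subcritical, i.e. $\|T_\kappa\|<1$, then $\chi(\kappa;x)=(I-T_\kappa)^{-1}1(x)$ for a.e. $x$, and $\chi(\kappa)=\langle(I-T_\kappa)^{-1}1,1\rangle_\mu<\infty$. (ii) Suppose that $\kappa$ is supercritical, i.e. $\|T_\kappa\|>1$, and also that $\|\hat T_\kappa\|<1$. Then $\hat\chi(\kappa;x)=(1-\rho(\kappa;x))(I-\hat T_\kappa)^{-1}1(x)$ for a.e. $x$, and $\hat\chi(\kappa)=\langle(I-\hat T_\kappa)^{-1}1,1\rangle_{\hat\mu}<\infty$. The conditions of (ii) hold whenever $\|T_\kappa\|>1$, $\kappa$ is quasi-irreducible, and $\int_{\mathcal S^2}\kappa^2<\infty$.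
   Context: A kernel is a symmetric measurable $\kappa:\mathcal S^2\to[0,\infty)$ with $\int\kappa<\infty$ and $\int\kappa(x,y)d\mu(y)<\infty$ for all $x$. Branching process $\mathfrak X_\kappa(x)$: one particle of type $x$; each particle of type $y$ independently has children whose types form a Poisson process with intensity $\kappa(y,z)\,d\mu(z)$. $\rho(\kappa;x)=\mathbb P(|\mathfrak X_\kappa(x)|=\infty)$; $\chi(\kappa;x)=\mathbb E|\mathfrak X_\kappa(x)|$, $\hat\chi(\kappa;x)=\mathbb E(|\mathfrak X_\kappa(x)|;|\mathfrak X_\kappa(x)|<\infty)$, $\chi(\kappa)=\int\chi(\kappa;x)d\mu$, $\hat\chi(\kappa)=\int\hat\chi(\kappa;x)d\mu$. $T_\kappa f(x)=\int\kappa(x,y)f(y)d\mu(y)$; $\|T_\kappa\|=\sup\{\|T_\kappa f\|_{L^2(\mu)}:f\ge0,\|f\|_{L^2(\mu)}\le1\}$. $\hat\mu$: $d\hat\mu=(1-\rho(\kappa;x))d\mu$; $\hat T_\kappa f(x)=\int\kappa(x,y)f(y)d\hat\mu(y)$, regarded as an operator on $L^2(\hat\mu)$, with norm defined analogously. $\langle f,g\rangle_\nu=\int fg\,d\nu$; $1$ the constant function. $\kappa$ is irreducible if there is no measurable $A$ with $0<\mu(A)<1$ and $\kappa=0$ a.e. on $A\times(\mathcal S\setminus A)$; quasi-irreducible if there is a measurable $\mathcal S'$ with $\mu(\mathcal S')>0$ such that $\kappa$ restricted to $\mathcal S'\times\mathcal S'$ is irreducible and $\kappa(x,y)=0$ whenever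 $x\notin\mathcal S'$ or $y\notin\mathcal S'$. *)

(* Defs.v *)
From HB Require Import structures.
From mathcomp Require Import all_boot all_order all_algebra.
From mathcomp Require Import all_classical all_reals all_analysis.
Import Order.TTheory GRing.Theory Num.Theory.
Import numFieldNormedType.Exports.

Set Implicit Arguments.
Unset Strict Implicit.
Unset Printing Implicit Defensive.

Local Open Scope classical_set_scope.
Local Open Scope ring_scope.

Inductive ttree (A : Type) : Type := TNode of A & seq (ttree A).
Arguments TNode {A}.

Fixpoint tsize {A} (t : ttree A) : nat :=
  let: TNode _ cs := t in (sumn (map tsize cs)).+1.

Fixpoint ttrunc {A} (n : nat) (t : ttree A) {struct n} : ttree A :=
  let: TNode a cs := t in
  match n with 0 => TNode a [::] | n'.+1 => TNode a (map (ttrunc n') cs) end.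

Fixpoint tmatch {A} (t : ttree A) (T : ttree (set A)) {struct t} : Prop :=
  let: TNode a cs := t in let: TNode B Cs := T in
  B a /\
  (fix ml (cs : seq (ttree A)) (Cs : seq (ttree (set A))) {struct cs} : Prop :=
     match cs, Cs with
     | [::], [::] => True
     | c :: cs', C :: Cs' => tmatch c C /\ ml cs' Cs'
     | _, _ => False
     end) cs Cs.

Section Defs.
Context {R : realType} {d : measure_display} {S : measurableType d}.
Variables (mu : probability S R) (kappa : S -> S -> R).

Fixpoint tmeas (T : ttree (set S)) : Prop :=
  let: TNode B Cs := T in
  measurable B /\
  (fix ml (Cs : seq (ttree (set S))) : Prop :=
     match Cs with [::] => True | C :: Cs' => tmeas C /\ ml Cs' end) Cs.

Definition is_kernel : Prop :=
  [/\ (forall x y, 0 <= kappa x y),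
      (forall x y, kappa x y = kappa y x),
      measurable_fun setT (fun z : S * S => kappa z.1 z.2),
      (\int[(mu \x mu)%E]_z (kappa z.1 z.2)%:E < +oo)%E &
      (forall x, \int[mu]_y (kappa x y)%:E < +oo)%E].

(* total intensity of the offspring Poisson process of a type-x particle *)
Definition lam (x : S) : R := fine (\int[mu]_y (kappa x y)%:E).

(* Probability that the first n generations of the branching process started
   at type x, with children listed in sampling order (Poisson(lam x) many
   children with i.i.d. types of law kappa(x,.)dmu/lam x), have exactly the
   shape of T and types in the corresponding sets of T. *)
Fixpoint cyl_prob (n : nat) (x : S) (T : ttree (set S)) {struct n} : \bar R :=
  let: TNode B Cs := T in
  match n with
  | 0 => if Cs is [::] then (\1_B x)%:E else 0%E
  | n'.+1 => ((\1_B x)%:E * (expR (- lam x) / (size Cs)`!%:R)%:E *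
      \big[*%E/1%E]_(C <- Cs) \int[mu]_y ((kappa x y)%:E * cyl_prob n' y C))%E
  end.

Section Process.
Context {dO : measure_display} {Om : measurableType dO}.
Variables (P : S -> probability Om R) (X : nat -> Om -> ttree S).

(* (Om, P x, X) realizes the branching process X_kappa(x) for every x:
   X n w is the tree of the first n generations (consistently truncated) *)
Definition is_branching_process : Prop :=
  (forall n w, ttrunc n (X n.+1 w) = X n w) /\
  (forall x n T, tmeas T ->
     measurable [set w | tmatch (X n w) T] /\
     P x [set w | tmatch (X n w) T] = cyl_prob n x T).

Definition tot (w : Om) : \bar R :=
  ereal_sup (range (fun n => ((tsize (X n w))%:R)%:E)).

Definition rho (x : S) : R := fine (P x [set w | tot w = +oo%E]).
Definition chi (x : S) : \bar R := \int[P x]_w tot w.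
Definition chihat (x : S) : \bar R :=
  \int[P x]_(w in [set w | (tot w < +oo)%E]) tot w.
Definition chi_tot : \bar R := \int[mu]_x chi x.
Definition chihat_tot : \bar R := \int[mu]_x chihat x.
End Process.

(* Weighted operator: T^w f(x) = int kappa(x,y) f(y) w(y) dmu(y);
   w = 1 gives T_kappa, w = 1 - rho gives hat T_kappa (d hat mu = (1-rho) d mu). *)
Definition Top (w f : S -> R) (x : S) : \bar R :=
  \int[mu]_y (kappa x y * f y * w y)%:E.

Definition wnorm2 (w : S -> R) (F : S -> \bar R) : \bar R :=
  poweR (\int[mu]_x ((w x)%:E * (F x * F x)))%E (2^-1).

Definition opnorm (w : S -> R) : \bar R :=
  ereal_sup [set wnorm2 w (Top w f) | f in
    [set f : S -> R | [/\ measurable_fun setT f, (forall x, 0 <= f x) &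
                         (wnorm2 w (fun x => (f x)%:E) <= 1)%E]]].

Definition irreducible_on (S' : set S) : Prop :=
  forall A, measurable A -> A `<=` S' ->
    {ae (mu \x mu)%E, forall z : S * S, A z.1 -> (S' `\` A) z.2 -> kappa z.1 z.2 = 0} ->
    mu A = 0%E \/ mu A = mu S'.

Definition quasi_irreducible : Prop :=
  exists S', [/\ measurable S', (0 < mu S')%E, irreducible_on S' &
    forall x y, ~ S' x \/ ~ S' y -> kappa x y = 0].

End Defs.

(* Main.v *)
(* The shape of the first n generations has an explicit law on finite trees,
   p(Node(c_1 .. c_k)) = exp(-lam(x))/k! prod_i int kappa(x,y) p(y, c_i) dmu(y).
   Summing over k like an exponential series, the mass M_n and the mean size E_n
   of this law satisfy M_(n+1) = exp(-lam + T M_n), E_(n+1) = M_(n+1) (1 + T E_n).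
   Unrestricted trees (M_n = 1) give chi as the Neumann series sum_k T^k 1; trees
   extinct before generation n give 1 - rho = exp(-T rho) > 0 and
   chihat / (1 - rho) as the Neumann series of hat T. In operator norm < 1 this
   series is bounded in L^2 and the L^2 solution of g = 1 + T g is unique.

   The last claim needs no spectral theory. By the Schur test with test function
   rho, <g, hat T f> is controlled by the multiplier m = (1 - rho) T rho / rho < 1;
   f, g can nearly saturate the bound only by concentrating where m is near 1,
   which the square integrability of kappa excludes. Positivity of rho on S'
   follows from irreducibility once rho is not a.e. zero; and if rho = 0 a.e., the
   Schur test with the probabilities of surviving n generations, whose
   multipliers tend to 1, gives ||T|| <= 1. *)
Require Import Defs.
From HB Require Import structures.
From mathcomp Require Import all_boot all_order all_algebra.
From mathcomp Require Import all_classical all_reals all_analysis.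
From mathcomp Require Import measurable_realfun ring lra.
Import Order.TTheory GRing.Theory Num.Theory.
Import numFieldNormedType.Exports.
Local Open Scope classical_set_scope.
Local Open Scope ring_scope.
(* [tuple] exports another [tsize]. *)
Local Notation tsize := Defs.tsize.

(** * Finite trees and sums over them *)

(** The process is given only through probabilities of cylinder events, so nothing can be
    conditioned on the first generation directly. Forgetting the types leaves countably many shapes;
    size and extinction depend on the shape alone, so integrals over the sample space become sums
    over shapes, and the branching recursion becomes an identity between series. Because all
    quantities are suprema of nonnegative extended-real sequences, [chi] and [chihat] are identified
    with Neumann series before any norm bound; the operator norm only makes the limit finite and the
    solution unique.

    In the last claim the obstacle is that the multiplier m is below 1 pointwise but approaches 1
    where T rho approaches 0, so the Schur test alone gives no gap. What it loses is the mass that f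
    and g put on the defect 1 - m. When both defect masses are small, a weighted AM-GM inequality,
    with a weight of order n on the product of the defects, keeps the form close to 1/2. Trading one
    bound against the other gives the explicit norm bound (n + 1) / (n + 2). *)

Section Trees.
Context {A : Type}.

(** The hypothesis on the subtrees is a [foldr] conjunction, since membership [c \in cs] would
    require decidable equality on [A]. *)
Lemma ttree_nested_ind (Q : ttree A -> Prop) :
  (forall a cs, foldr (fun c => and (Q c)) True cs -> Q (TNode a cs)) ->
  forall t, Q t.
Proof.
move=> H; fix F 1 => -[a cs]; apply: H.
by elim: cs => [//|c cs IH] /=; split; [exact: F|exact: IH].
Qed.

Fixpoint shape (t : ttree A) : ttree unit :=
  let: TNode _ cs := t in TNode tt (map shape cs).

(** The pattern matched by exactly the trees of a given shape; it turns a shape into a cylinder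
    event. *)
Fixpoint full (t : ttree unit) : ttree (set A) :=
  let: TNode _ cs := t in TNode setT (map full cs).

(** Says that generation [n] is empty; generation [0] holds the root, hence the value [false]
    there. *)
Fixpoint dead (n : nat) (t : ttree A) {struct n} : bool :=
  let: TNode _ cs := t in if n is n'.+1 then all (dead n') cs else false.

Lemma tsize_trunc n (t : ttree A) : (tsize (ttrunc n t) <= tsize t)%N.
Proof.
elim: n t => [|n IH] [a cs] //=; rewrite ltnS; elim: cs => //= c cs IHc.
by rewrite leq_add.
Qed.

(** Truncation keeps generation [n] itself, so its emptiness shows that nothing was cut off. *)
Lemma dead_ttrunc n (t : ttree A) : dead n (ttrunc n t) -> ttrunc n t = t.
Proof.
elim: n t => [|n IH] [a cs] //= H; congr TNode.
by elim: cs H => //= c cs IHc /andP[/IH -> /IHc ->].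
Qed.

Lemma deadS n (t : ttree A) : dead n t -> dead n.+1 t.
Proof.
elim: n t => [|n IH] [a cs] // H; rewrite -[dead _ _]/(all (dead n.+1) cs).
by apply: sub_all H => c; exact: IH.
Qed.

(** One particle in each of the generations 0, ..., n already makes n + 1 of them. *)
Lemma tsize_not_dead n (t : ttree A) : ~~ dead n t -> (n < tsize t)%N.
Proof.
elim: n t => [|n IH] [a cs] //=; rewrite ltnS.
by elim: cs => //= c cs IHc; rewrite negb_and => /orP[/IH|/IHc] H;
  rewrite ?(leq_trans H) ?leq_addr ?leq_addl.
Qed.

End Trees.

Lemma shape_tsize {A} (t : ttree A) : tsize (shape t) = tsize t.
Proof.
elim/@ttree_nested_ind: t => a cs H /=; congr (_.+1).
by elim: cs H => //= c cs IH [-> /IH ->].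
Qed.

Lemma shape_dead {A} n (t : ttree A) : dead n (shape t) = dead n t.
Proof.
elim: n t => [|n IH] [a cs] //=; rewrite all_map; exact: eq_all.
Qed.

Lemma tmatch_full {A} (t : ttree A) (s : ttree unit) :
  tmatch t (full s) <-> shape t = s.
Proof.
elim/@ttree_nested_ind: t s => a cs H [[] ss] /=.
split=> [[_ M]|[<-]].
  congr TNode; elim: cs ss H M => [|c cs IH] [|s ss] //= [Hc Hcs] [/Hc -> M].
  by rewrite (IH ss).
split=> //; elim: cs H => //= c cs IH [Hc Hcs]; split; first exact/Hc.
exact: IH.
Qed.

Lemma tmeas_full d (S : measurableType d) (s : ttree unit) :
  tmeas (full s : ttree (set S)).
Proof.
elim/@ttree_nested_ind: s => a cs H /=; split; first exact: measurableT.
by elim: cs H => //= c cs IH [Hc /IH]; split.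
Qed.

(** Embedding into generic trees makes shapes a countable type; the label [0] is a dummy. *)
Fixpoint ttree_enc (t : ttree unit) : GenTree.tree unit :=
  let: TNode _ cs := t in GenTree.Node 0 (map ttree_enc cs).
Fixpoint ttree_dec (t : GenTree.tree unit) : ttree unit :=
  if t is GenTree.Node _ cs then TNode tt (map ttree_dec cs) else TNode tt [::].

Lemma ttree_encK : cancel ttree_enc ttree_dec.
Proof.
elim/@ttree_nested_ind => -[] cs H /=; congr TNode.
by elim: cs H => //= c cs IH [-> /IH ->].
Qed.

HB.instance Definition _ := Countable.copy (ttree unit) (can_type ttree_encK).

Lemma TNode_bij : set_bij [set: seq (ttree unit)] [set: ttree unit] (TNode tt).
Proof.
split=> //; first by move=> x y _ _ [].
by move=> [[] cs] _; exists cs.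
Qed.

(** * Sums over a countable type and their integrals *)

Section ESum.
Context {R : realType}.
Local Open Scope ereal_scope.

(** Enumeration by [pickle] turns the unordered sum into a series, to which the convergence theorems
    for integrals of series apply. *)
Lemma esum_countE (C : countType) (a : C -> \bar R) : (forall c, 0 <= a c) ->
  \esum_(c in setT) a c = \sum_(k <oo) (oapp a 0 (pickle_inv k)).
Proof.
move=> a0; rewrite nneseries_esumT; last by move=> n; case: pickle_inv => //=.
rewrite [RHS](esumID (range (@pickle C))); last by move=> n _; case: pickle_inv => //=.
rewrite !setTI [X in _ + X]esum1 ?adde0; last first.
  move=> n /= H; case E : (pickle_inv n) => [c|] //=; exfalso; apply: H.
  by exists c => //; have := @pickle_invK C n; rewrite E /=.
rewrite (reindex_esum setT (range (@pickle C)) (@pickle C)); last first.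
  by apply: inj_bij => x y _ _; exact: (pcan_inj pickleK).
by apply: eq_esum => c _; rewrite pickleK_inv.
Qed.

(** The factor may be infinite; read as an integral against counting measure, the series inherits
    the scaling rule of integrals. *)
Lemma nneseriesZle (k : \bar R) (a : nat -> \bar R) :
  0 <= k -> (forall n, 0 <= a n) ->
  \sum_(n <oo) (k * a n) = k * \sum_(n <oo) a n.
Proof.
move=> k0 a0; rewrite -!ge0_integral_count//; last by move=> n; exact: mule_ge0.
by rewrite ge0_integralZl.
Qed.

Lemma esumZl (C : countType) (D : set C) (k : \bar R) (a : C -> \bar R) :
  0 <= k -> (forall c, 0 <= a c) ->
  \esum_(c in D) (k * a c) = k * \esum_(c in D) a c.
Proof.
move=> k0 a0; rewrite esum_mkcond [in RHS]esum_mkcond.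
pose b c := if c \in D then a c else 0.
have b0 c : 0 <= b c by rewrite /b; case: ifP.
transitivity (\esum_(c in setT) (k * b c)).
  by apply: eq_esum => c _; rewrite /b; case: ifP => // _; rewrite mule0.
rewrite !esum_countE//; last by move=> c; exact: mule_ge0.
rewrite -nneseriesZle//; last by move=> i; case: pickle_inv => //=.
by apply: eq_eseriesr => i _; case: pickle_inv => //=; rewrite mule0.
Qed.

Context d (T : measurableType d) (mu : {measure set T -> \bar R}).

Lemma integral_esum (C : countType) (f : C -> T -> \bar R) :
  (forall c, measurable_fun setT (f c)) -> (forall c x, 0 <= f c x) ->
  \int[mu]_x (\esum_(c in setT) f c x) = \esum_(c in setT) \int[mu]_x f c x.
Proof.
move=> mf f0; under eq_integral do rewrite esum_countE//.
rewrite esum_countE; last by move=> c; exact: integral_ge0.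
rewrite integral_nneseries//.
- by apply: eq_eseriesr => i _; case: pickle_inv => //=; rewrite integral0.
- by move=> n; case: pickle_inv => //=.
- by move=> n x _; case: pickle_inv => //=.
Qed.

Lemma measurable_esum (C : countType) (f : C -> T -> \bar R) :
  (forall c, measurable_fun setT (f c)) -> (forall c x, 0 <= f c x) ->
  measurable_fun setT (fun x => \esum_(c in setT) f c x).
Proof.
move=> mf f0; under eq_fun do rewrite esum_countE//.
apply: (@emeasurable_fun_cvg _ _ _ _ (fun n x => \sum_(0 <= k < n) oapp (f^~ x) 0
    (pickle_inv k))).
  by move=> n; apply: emeasurable_sum => i; case: pickle_inv => [c|] /=;
    [exact: mf|exact: measurable_cst].
move=> x _; apply: is_cvg_nneseries => n _ _; case: pickle_inv => //=.
Qed.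

Section Countable.
Variables (C : countType) (Y : T -> C) (f : C -> \bar R).
Hypothesis mY : forall c, measurable [set x | Y x = c].
Hypothesis f0 : forall c, 0 <= f c.

Let fYE x : f (Y x) = \esum_(c in setT) (f c * (\1_[set x | Y x = c] x)%:E).
Proof.
rewrite (esumID [set Y x]); last by move=> c _; rewrite mule_ge0// lee_fin.
rewrite !setTI esum_set1 ?mule_ge0 ?lee_fin// esum1 ?adde0.
  by rewrite indicE mem_set// mule1.
move=> c /= cY; rewrite indicE memNset ?mule0//= => H; exact: cY.
Qed.

Let mfY c : measurable_fun [set: T] (fun x => f c * (\1_[set x | Y x = c] x)%:E).
Proof. by apply: emeasurable_funM => //; exact/measurable_EFinP. Qed.

Let fY0 c x : 0 <= f c * (\1_[set x | Y x = c] x)%:E.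
Proof. by rewrite mule_ge0// lee_fin. Qed.

Lemma measurable_countable : measurable_fun [set: T] (fun x => f (Y x)).
Proof. by under eq_fun do rewrite fYE; exact: measurable_esum. Qed.

(** Change of variables fibre by fibre: what enters is the measurability of each event [Y x = c],
    which is what the cylinder events supply. *)
Lemma integral_countable :
  \int[mu]_x f (Y x) = \esum_(c in setT) (f c * mu [set x | Y x = c]).
Proof.
under eq_integral do rewrite fYE.
rewrite integral_esum//; apply: eq_esum => c _; rewrite ge0_integralZl//.
  by rewrite integral_indic// setIT.
exact/measurable_EFinP.
Qed.

End Countable.

Lemma integral_ereal_sup (f : nat -> T -> \bar R) :
  (forall n, measurable_fun setT (f n)) -> (forall n x, 0 <= f n x) ->
  (forall n x, f n x <= f n.+1 x) ->
  \int[mu]_x ereal_sup (range (f^~ x)) =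
  ereal_sup (range (fun n => \int[mu]_x f n x)).
Proof.
move=> mf f0 nd.
have ndx x : nondecreasing_seq (f^~ x) by apply/nondecreasing_seqP => n.
transitivity (\int[mu]_x limn (f^~ x)).
  by apply: eq_integral => x _; apply/esym/cvg_lim => //; exact: ereal_nondecreasing_cvgn.
rewrite monotone_convergence//.
apply/cvg_lim => //; apply: ereal_nondecreasing_cvgn.
by apply/nondecreasing_seqP => n; apply: ge0_le_integral.
Qed.

End ESum.

(** * Exponential series over lists: the algebra of Poisson offspring *)

Section PoissonSum.
Context {R : realType} {C : countType}.
Variables (q s : C -> \bar R).
Hypothesis q0 : forall c, (0 <= q c)%E.
Hypothesis s0 : forall c, (0 <= s c)%E.
Local Open Scope ereal_scope.

Lemma prode_ge0 (I : Type) (r : seq I) (f : I -> \bar R) :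
  (forall i, 0 <= f i) -> 0 <= \big[*%E/1]_(i <- r) f i.
Proof. by move=> f0; elim/big_ind : _ => //; exact: mule_ge0. Qed.

Lemma esum_seqE (F : seq C -> \bar R) : (forall l, 0 <= F l) ->
  \esum_(l in setT) F l = \sum_(k <oo) \esum_(l in [set l | size l = k]) F l.
Proof.
move=> F0; rewrite -nneseries_sum_bigcup//.
  by congr esum; apply/seteqP; split => // l _; exists (size l).
by move=> i j _ _ [l [/= <- <-]].
Qed.

Lemma esum_seqS (F : seq C -> \bar R) k : (forall l, 0 <= F l) ->
  \esum_(l in [set l | size l = k.+1]) F l =
  \esum_(c in setT) \esum_(l in [set l | size l = k]) F (c :: l).
Proof.
move=> F0; rewrite esum_esum//.
apply: (reindex_esum _ _ (fun p : C * seq C => p.1 :: p.2)); split.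
- by move=> [c l] [_ /= ->].
- by move=> [c l] [c' l'] _ _ [-> ->].
- by move=> [//|c l] [/= <-]; exists (c, l).
Qed.

Lemma esum_size0 (F : seq C -> \bar R) : (forall l, 0 <= F l) ->
  \esum_(l in [set l | size l = 0%N]) F l = F [::].
Proof.
move=> F0; rewrite -(@esum_set1 _ _ [::] F)//; congr esum.
by apply/seteqP; split => [[]|_ ->].
Qed.

Let r := \esum_(c in setT) q c.
Let Q := \esum_(c in setT) (q c * s c).

Let r0 : 0 <= r. Proof. exact: esum_ge0. Qed.
Let Q0 : 0 <= Q. Proof. by apply: esum_ge0 => c _; exact: mule_ge0. Qed.
Let sum0 (l : seq C) : 0 <= \sum_(c <- l) s c. Proof. exact: sume_ge0. Qed.
Let prod0 (l : seq C) : 0 <= \big[*%E/1]_(c <- l) q c.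
Proof. exact: prode_ge0. Qed.

Lemma esum_size_prod k :
  \esum_(l in [set l | size l = k]) \big[*%E/1]_(c <- l) q c = r ^+ k.
Proof.
elim: k => [|k IH]; first by rewrite esum_size0 ?big_nil.
rewrite esum_seqS//.
transitivity (\esum_(c in setT) (r ^+ k * q c)); last first.
  by rewrite esumZl ?expe_ge0// expeS muleC.
apply: eq_esum => c _; under eq_esum do rewrite big_cons.
by rewrite esumZl// IH muleC.
Qed.

(** Marking one of the k + 1 positions gives [Q] at the mark and [r] at each other place. The
    induction removes the head, which either is the marked position or contributes a factor [r]. *)
Lemma esum_size_prod_sum k :
  \esum_(l in [set l | size l = k.+1])
    (\big[*%E/1]_(c <- l) q c * \sum_(c <- l) s c) = (k.+1)%:R%:E * (r ^+ k * Q).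
Proof.
have step j : \esum_(l in [set l | size l = j.+1])
    (\big[*%E/1]_(c <- l) q c * \sum_(c <- l) s c) =
    r ^+ j * Q + r * \esum_(l in [set l | size l = j])
    (\big[*%E/1]_(c <- l) q c * \sum_(c <- l) s c).
  rewrite esum_seqS; last by move=> l; exact: mule_ge0.
  set B := \esum_(l in [set l | size l = j]) _.
  transitivity (\esum_(c in setT) (r ^+ j * (q c * s c) + B * q c)).
    apply: eq_esum => c _.
    transitivity (\esum_(l in [set l | size l = j])
       ((q c * s c) * \big[*%E/1]_(c <- l) q c +
        q c * (\big[*%E/1]_(c <- l) q c * \sum_(c <- l) s c))).
      apply: eq_esum => l _; rewrite !big_cons ge0_muleDr//.
      by rewrite -!muleA; congr (_ * _ + _); rewrite muleC.
    rewrite esumD; last 2 first.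
    - by move=> l _; rewrite !mule_ge0.
    - by move=> l _; rewrite !mule_ge0.
    rewrite !esumZl ?mule_ge0//; last by move=> l; rewrite mule_ge0.
    by rewrite esum_size_prod; congr (_ + _); rewrite muleC.
  have B0 : 0 <= B by apply: esum_ge0 => l _; rewrite mule_ge0.
  rewrite esumD; last 2 first.
  - by move=> c _; rewrite !mule_ge0 ?expe_ge0.
  - by move=> c _; rewrite mule_ge0.
  rewrite !esumZl ?expe_ge0//; last by move=> c; rewrite mule_ge0.
  by congr (_ + _); rewrite muleC.
elim: k => [|k IH].
  rewrite step esum_size0; last by move=> l; rewrite mule_ge0.
  by rewrite !big_nil !mule0 adde0 -[1%:R%:E]/1%E mul1e.
rewrite step IH muleCA [r * (_ * Q)]muleA -expeS -[X in X + _]mul1e -ge0_muleDl ?lee_fin//.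
Qed.

Hypothesis r_fin : r \is a fin_num.

Lemma sum_exp_coeffE (x : R) : (0 <= x)%R ->
  \sum_(k <oo) (x ^+ k / k`!%:R)%:E = (expR x)%:E :> \bar R.
Proof.
move=> x0; have := is_cvg_series_exp_coeff x => /(EFin_lim) <-.
by congr (limn _); apply/funext => n /=; rewrite sumEFin.
Qed.

Let fact_ge0 (k : nat) : 0 <= ((k`!%:R)^-1 : R)%:E. Proof. by rewrite lee_fin. Qed.

Let rE : r = (fine r)%:E. Proof. by rewrite fineK. Qed.

Let fr0 : (0 <= fine r)%R. Proof. exact: fine_ge0. Qed.

(** Lists of length k contribute r^k / k!, so the sum is the exponential series; multiplied by
    exp(-lam) it is the generating function of a Poisson number of children. *)
Lemma esum_poisson_prod :
  \esum_(l in setT) (((size l)`!%:R^-1)%:E * \big[*%E/1]_(c <- l) q c) =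
  (expR (fine r))%:E.
Proof.
rewrite esum_seqE; last by move=> l; exact: mule_ge0.
rewrite -sum_exp_coeffE//; apply: eq_eseriesr => k _.
transitivity (\esum_(l in [set l | size l = k])
    ((k`!%:R^-1)%:E * \big[*%E/1]_(c <- l) q c)).
  by apply: eq_esum => l /= ->.
by rewrite esumZl// esum_size_prod rE -EFin_expe -EFinM mulrC.
Qed.

Lemma esum_poisson_prod_sum :
  \esum_(l in setT) (((size l)`!%:R^-1)%:E *
    (\big[*%E/1]_(c <- l) q c * (1 + \sum_(c <- l) s c))) =
  (expR (fine r))%:E * (1 + Q).
Proof.
transitivity (\esum_(l in setT) (((size l)`!%:R^-1)%:E * \big[*%E/1]_(c <- l) q c)
  + \esum_(l in setT) (((size l)`!%:R^-1)%:E *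
    (\big[*%E/1]_(c <- l) q c * \sum_(c <- l) s c))).
  rewrite -esumD; last 2 first.
  - by move=> l _; exact: mule_ge0.
  - by move=> l _; rewrite !mule_ge0.
  by apply: eq_esum => l _; rewrite ge0_muleDr// mule1 ge0_muleDr// mule_ge0.
rewrite esum_poisson_prod ge0_muleDr// mule1; congr (_ + _).
rewrite esum_seqE; last by move=> l; rewrite !mule_ge0.
(* The empty list contributes nothing; after the shift by one, (k + 1) / (k + 1)! becomes 1 / k!. *)
rewrite nneseries_recl//; last by move=> n _; apply: esum_ge0 => l _; rewrite !mule_ge0.
rewrite -nneseries_addn; last by move=> n; apply: esum_ge0 => l _; rewrite !mule_ge0.
rewrite esum_size0; last by move=> l; rewrite !mule_ge0.
rewrite !big_nil mule0 mule0 add0e.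
rewrite -sum_exp_coeffE// muleC -nneseriesZle//; last first.
  by move=> n; rewrite lee_fin divr_ge0// exprn_ge0.
apply: eq_eseriesr => k _; rewrite addn1.
transitivity (\esum_(l in [set l | size l = k.+1])
    ((k.+1`!%:R^-1)%:E * (\big[*%E/1]_(c <- l) q c * \sum_(c <- l) s c))).
  by apply: eq_esum => l /= ->.
rewrite esumZl//; last by move=> l; rewrite !mule_ge0.
rewrite esum_size_prod_sum [in LHS]rE -EFin_expe muleA muleA muleC; congr (_ * _).
rewrite -!EFinM; congr EFin; rewrite factS natrM.
by field; rewrite addrC natr1 !pnatr_eq0 -lt0n fact_gt0.
Qed.

End PoissonSum.

(** * The kernel operator *)

Section Kernel.
Context {R : realType} {d : measure_display} {S : measurableType d}.
Variables (mu : probability S R) (kappa : S -> S -> R).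
Hypothesis Hk : is_kernel mu kappa.
Local Open Scope ereal_scope.

(** Extended-real arguments keep the operator defined along increasing suprema, with no finiteness
    to check; the real-valued [Top] is related to it by [TopE]. *)
Definition kop (h : S -> \bar R) (x : S) : \bar R :=
  \int[mu]_y ((kappa x y)%:E * h y).

Lemma kernel_ge0 x y : (0 <= kappa x y)%R.
Proof. by have [] := Hk. Qed.

Lemma kernel_sym x y : kappa x y = kappa y x.
Proof. by have [] := Hk. Qed.

Lemma measurable_kernel_snd x : measurable_fun [set: S] (kappa x).
Proof.
have [_ _ mk _ _] := Hk.
apply: (measurableT_comp (f := fun z : S * S => kappa z.1 z.2)
  (g := fun y => (x, y))) => //.
exact: measurable_pair1.
Qed.

Lemma measurable_kernel_prod (h : S -> \bar R) : measurable_fun [set: S] h ->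
  measurable_fun [set: S * S] (fun z => (kappa z.1 z.2)%:E * h z.2).
Proof.
have [_ _ mk _ _] := Hk => mh; apply: emeasurable_funM.
  exact/measurable_EFinP.
exact: measurableT_comp.
Qed.

Lemma kop_integrand_meas (h : S -> \bar R) x : measurable_fun [set: S] h ->
  measurable_fun [set: S] (fun y => (kappa x y)%:E * h y).
Proof.
by move=> mh; apply: emeasurable_funM => //; apply/measurable_EFinP;
  exact: measurable_kernel_snd.
Qed.

Lemma kop_integrand_ge0 (h : S -> \bar R) x y : (forall y, 0 <= h y) ->
  0 <= (kappa x y)%:E * h y.
Proof. by move=> h0; rewrite mule_ge0// lee_fin kernel_ge0. Qed.

Lemma kop_ge0 (h : S -> \bar R) x : (forall y, 0 <= h y) -> 0 <= kop h x.
Proof. by move=> h0; apply: integral_ge0 => y _; exact: kop_integrand_ge0. Qed.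

Lemma kop_meas (h : S -> \bar R) : measurable_fun [set: S] h ->
  (forall y, 0 <= h y) -> measurable_fun [set: S] (kop h).
Proof.
move=> mh h0.
apply: (measurable_fun_fubini_tonelli_F (fun z : S * S => (kappa z.1 z.2)%:E * h z.2)).
  exact: measurable_kernel_prod.
by move=> z; exact: kop_integrand_ge0.
Qed.

Lemma le_kop (g h : S -> \bar R) x : measurable_fun [set: S] g ->
  measurable_fun [set: S] h -> (forall y, 0 <= g y) ->
  {ae mu, forall y, g y <= h y} -> (forall y, 0 <= h y) -> kop g x <= kop h x.
Proof.
move=> mg mh g0 gh h0; apply: ae_ge0_le_integral => //.
- by move=> y _; exact: kop_integrand_ge0.
- exact: kop_integrand_meas.
- by move=> y _; exact: kop_integrand_ge0.
- exact: kop_integrand_meas.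
- by apply: filterS gh => y gh _; rewrite lee_wpmul2l// lee_fin kernel_ge0.
Qed.

Lemma kopZ (h : S -> \bar R) (k : \bar R) x : measurable_fun [set: S] h ->
  (forall y, 0 <= h y) -> 0 <= k -> kop (fun y => k * h y) x = k * kop h x.
Proof.
move=> mh h0 k0; rewrite -ge0_integralZl//.
- by apply: eq_integral => y _; rewrite muleCA.
- exact: kop_integrand_meas.
- by move=> y _; exact: kop_integrand_ge0.
Qed.

Lemma kop_sup (f : nat -> S -> \bar R) x :
  (forall n, measurable_fun [set: S] (f n)) -> (forall n x, 0 <= f n x) ->
  (forall n x, f n x <= f n.+1 x) ->
  kop (fun y => ereal_sup (range (f^~ y))) x =
  ereal_sup (range (fun n => kop (f n) x)).
Proof.
move=> mf f0 nd; rewrite -(integral_ereal_sup _ _ mu (fun n y => (kappa x y)%:E * f n y)).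
- apply: eq_integral => y _.
  have nf : nondecreasing_seq (f^~ y) by apply/nondecreasing_seqP.
  transitivity (limn (fun n => (kappa x y)%:E * f n y)).
    apply/esym/cvg_lim => //; apply: cvgeZl => //.
    exact: ereal_nondecreasing_cvgn.
  apply/cvg_lim => //; apply: ereal_nondecreasing_cvgn => a b ab.
  by rewrite lee_wpmul2l ?lee_fin ?kernel_ge0// nf.
- by move=> n; exact: kop_integrand_meas.
- by move=> n y; exact: kop_integrand_ge0.
- by move=> n y; rewrite lee_wpmul2l ?lee_fin ?kernel_ge0.
Qed.

Lemma kop_esum (C : countType) (f : C -> S -> \bar R) x :
  (forall c, measurable_fun [set: S] (f c)) -> (forall c x, 0 <= f c x) ->
  kop (fun y => \esum_(c in setT) f c y) x = \esum_(c in setT) kop (f c) x.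
Proof.
move=> mf f0; rewrite -integral_esum.
- by apply: eq_integral => y _; rewrite esumZl// lee_fin kernel_ge0.
- by move=> n; exact: kop_integrand_meas.
- by move=> n y; exact: kop_integrand_ge0.
Qed.

Lemma lamE x : kop (cst 1) x = (lam mu kappa x)%:E.
Proof.
rewrite /lam /kop; under eq_integral do rewrite mule1.
have [_ _ _ _ lamoo] := Hk; rewrite fineK// ge0_fin_numE//.
by apply: integral_ge0 => y _; rewrite lee_fin kernel_ge0.
Qed.

Lemma measurable_lam : measurable_fun [set: S] (lam mu kappa).
Proof.
apply/measurable_EFinP.
rewrite (_ : _ \o _ = kop (cst 1)); last by apply/funext => x; rewrite lamE.
by apply: kop_meas => // y /=; rewrite lee_fin.
Qed.

Lemma kop_le_lam (h : S -> \bar R) x : measurable_fun [set: S] h ->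
  (forall y, 0 <= h y <= 1) -> kop h x <= (lam mu kappa x)%:E.
Proof.
move=> mh h01; rewrite -lamE; apply: le_kop => //.
- by move=> y; have /andP[] := h01 y.
- by apply: aeW => y; have /andP[] := h01 y.
Qed.

Lemma kop_fin_num (h : S -> \bar R) x : measurable_fun [set: S] h ->
  (forall y, 0 <= h y <= 1) -> kop h x \is a fin_num.
Proof.
move=> mh h01; rewrite ge0_fin_numE;
  first by rewrite (le_lt_trans (kop_le_lam h x mh h01))// ltry.
by apply: kop_ge0 => y; have /andP[] := h01 y.
Qed.

(** Tonelli together with the symmetry of [kappa]. This self-adjointness lets the Schur test
    exchange the roles of its two variables. *)
Lemma kop_symm (g h : S -> \bar R) : measurable_fun [set: S] g ->
  measurable_fun [set: S] h -> (forall x, 0 <= g x) -> (forall x, 0 <= h x) ->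
  \int[mu]_x (g x * kop h x) = \int[mu]_x (h x * kop g x).
Proof.
move=> mg mh g0 h0.
have [_ _ mk _ _] := Hk.
transitivity (\int[mu]_x \int[mu]_y (g x * ((kappa x y)%:E * h y))).
  apply: eq_integral => x _; rewrite ge0_integralZl//.
  - exact: kop_integrand_meas.
  - by move=> y _; exact: kop_integrand_ge0.
rewrite (fubini_tonelli (fun z : S * S => g z.1 * ((kappa z.1 z.2)%:E * h z.2))) /=.
- apply: eq_integral => x _; rewrite -ge0_integralZl//.
  + by apply: eq_integral => y _; rewrite muleA muleC kernel_sym (muleC (g y)).
  + exact: kop_integrand_meas.
  + by move=> y _; exact: kop_integrand_ge0.
- apply: emeasurable_funM; last exact: measurable_kernel_prod.
  exact: measurableT_comp.
- by move=> z; rewrite mule_ge0// kop_integrand_ge0.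
Qed.

End Kernel.

(** * Law of the family tree *)

Section TreeLaw.
Context {R : realType} {d : measure_display} {S : measurableType d}.
Variables (mu : probability S R) (kappa : S -> S -> R).
Hypothesis Hk : is_kernel mu kappa.
Local Open Scope ereal_scope.
Local Notation K := (kop mu kappa).
Local Notation lam := (lam mu kappa).

(* [tree_law true n x] is the law of the shape of the first [n] generations;
   [tree_law false n x] is its restriction to the shapes that are extinct
   before generation [n]. *)
Fixpoint tree_law (b : bool) (n : nat) (x : S) (t : ttree unit) {struct n} : \bar R :=
  let: TNode _ cs := t in
  match n with
  | 0 => if cs is [::] then b%:R%:E else 0
  | n'.+1 => (expR (- lam x) / (size cs)`!%:R)%:E *
      \big[*%E/1]_(c <- cs) K (fun y => tree_law b n' y c) x
  end.

Lemma cyl_prob_full n x t : cyl_prob mu kappa n x (full t) = tree_law true n x t.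
Proof.
elim: n x t => [|n IH] x [[] cs] /=.
  by case: cs => //=; rewrite indicT.
rewrite indicT mul1e size_map big_map; congr (_ * _).
by apply: eq_bigr => c _; apply: eq_integral => y _; rewrite IH.
Qed.

Lemma prode_eq0 (I : Type) (r : seq I) (p : pred I) (f : I -> \bar R) :
  has p r -> (forall i, p i -> f i = 0) -> \big[*%E/1]_(i <- r) f i = 0.
Proof.
move=> + f0; elim: r => //= i r IH; rewrite big_cons.
by case/orP => [/f0 ->|/IH ->]; rewrite ?mul0e ?mule0.
Qed.

(** The restriction sits in the base case: weight [0] at depth [0] spreads upwards, because one
    child that is not extinct in time annihilates the whole product. *)
Lemma tree_lawF n x t :
  tree_law false n x t = if dead n t then tree_law true n x t else 0.
Proof.
elim: n x t => [|n IH] x [[] cs] /=; first by case: cs.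
case: ifPn => [/allP H|].
  congr (_ * _); apply: eq_big_seq => c /H dc.
  by apply: eq_integral => y _; rewrite IH dc.
rewrite -has_predC => H; rewrite (prode_eq0 _ _ _ _ H) ?mule0// => c /= ndc.
rewrite /kop; under eq_integral do rewrite IH (negbTE ndc) mule0.
by rewrite integral0.
Qed.

Lemma tree_law_ge0 b n x t : 0 <= tree_law b n x t.
Proof.
elim: n x t => [|n IH] x [[] cs] /=; first by case: cs => //=; rewrite lee_fin.
rewrite mule_ge0 ?lee_fin ?divr_ge0 ?expR_ge0// prode_ge0// => c.
by apply: kop_ge0 => // y; exact: IH.
Qed.

Lemma measurable_prode (I : Type) (r : seq I) (f : I -> S -> \bar R) :
  (forall i, measurable_fun [set: S] (f i)) ->
  measurable_fun [set: S] (fun x => \big[*%E/1]_(i <- r) f i x).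
Proof.
move=> mf; elim: r => [|i r IH].
  by under eq_fun do rewrite big_nil; exact: measurable_cst.
by under eq_fun do rewrite big_cons; exact: emeasurable_funM.
Qed.

Lemma measurable_tree_law b n t : measurable_fun [set: S] (tree_law b n ^~ t).
Proof.
elim: n t => [|n IH] [[] cs] /=; first by case: cs.
apply: emeasurable_funM.
  apply/measurable_EFinP; apply: measurable_funM => //.
  apply: measurableT_comp => //; apply: measurable_funN; exact: measurable_lam.
apply: measurable_prode => c; apply: kop_meas => // y; exact: tree_law_ge0.
Qed.

(** For [b = false] this is the probability that generation [n] is empty, and [law_size] is the
    expected size on that event. *)
Definition law_mass b n x := \esum_(t in [set: ttree unit]) tree_law b n x t.
Definition law_size b n x :=
  \esum_(t in [set: ttree unit]) (tree_law b n x t * (tsize t)%:R%:E).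

Lemma law_mass_ge0 b n x : 0 <= law_mass b n x.
Proof. by apply: esum_ge0 => t _; exact: tree_law_ge0. Qed.

Lemma law_size_ge0 b n x : 0 <= law_size b n x.
Proof. by apply: esum_ge0 => t _; rewrite mule_ge0 ?lee_fin// tree_law_ge0. Qed.

Lemma measurable_law_mass b n : measurable_fun [set: S] (law_mass b n).
Proof.
by apply: measurable_esum => [t|t x]; [exact: measurable_tree_law|exact: tree_law_ge0].
Qed.

Let tree_law_size_ge0 b n t x : 0 <= tree_law b n x t * (tsize t)%:R%:E.
Proof. by rewrite mule_ge0 ?lee_fin// tree_law_ge0. Qed.

Let measurable_tree_law_size b n t :
  measurable_fun [set: S] (fun x => tree_law b n x t * (tsize t)%:R%:E).
Proof. by apply: emeasurable_funM => //; exact: measurable_tree_law. Qed.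

Lemma measurable_law_size b n : measurable_fun [set: S] (law_size b n).
Proof. exact: measurable_esum. Qed.

Let law0 b (f : ttree unit -> \bar R) x : (forall t, 0 <= f t) ->
  \esum_(t in [set: ttree unit]) (tree_law b 0 x t * f t) = b%:R%:E * f (TNode tt [::]).
Proof.
move=> f0; rewrite (esumID [set TNode tt [::]]); last first.
  by move=> t _; rewrite mule_ge0 ?tree_law_ge0.
rewrite !setTI esum_set1 ?mule_ge0 ?lee_fin// esum1 ?adde0//.
by move=> [[] [|c cs]] H //=; rewrite ?mul0e//; case: H.
Qed.

Lemma law_mass0 b x : law_mass b 0 x = b%:R%:E.
Proof.
have := @law0 b (cst 1) x (fun=> lee01).
by rewrite mule1 => <-; apply: eq_esum => t _; rewrite mule1.
Qed.

Lemma law_size0 b x : law_size b 0 x = b%:R%:E.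
Proof. by rewrite /law_size law0 ?mule1// => t; rewrite lee_fin. Qed.

(** Shapes are indexed by their lists of subtrees, and summing the weight of one child over all
    shapes gives [K (law_mass b n) x]. The bound by 1 makes this exponent finite; it is a hypothesis
    because the induction of [law_mass_le1] passes through here. *)
Lemma law_massS b n x : (forall y, law_mass b n y <= 1) ->
  law_mass b n.+1 x = (expR (- lam x + fine (K (law_mass b n) x)))%:E.
Proof.
move=> le1; rewrite /law_mass (reindex_esum _ _ _ _ TNode_bij) /=.
transitivity (\esum_(cs in [set: seq (ttree unit)]) ((expR (- lam x))%:E *
   (((size cs)`!%:R^-1)%:E *
    \big[*%E/1]_(c <- cs) K (fun y => tree_law b n y c) x))).
  by apply: eq_esum => cs _; rewrite EFinM muleA.
have q0 c : 0 <= K (fun y => tree_law b n y c) x.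
  by apply: kop_ge0 => // y; exact: tree_law_ge0.
have E : \esum_(c in setT) K (fun y => tree_law b n y c) x = K (law_mass b n) x.
  rewrite -kop_esum// => [c|c y]; [exact: measurable_tree_law|exact: tree_law_ge0].
rewrite esumZl ?lee_fin ?expR_ge0//; last first.
  by move=> l; rewrite mule_ge0 ?lee_fin// prode_ge0.
rewrite esum_poisson_prod// E ?expRD ?EFinM//.
apply: kop_fin_num => //; first exact: measurable_law_mass.
by move=> y; rewrite law_mass_ge0 le1.
Qed.

Lemma law_mass_le1 b n x : law_mass b n x <= 1.
Proof.
elim: n x => [|n IH] x; first by rewrite law_mass0 lee_fin; case: b.
rewrite law_massS// lee_fin expR_le1 addrC subr_le0 -lee_fin fineK.
  by apply: kop_le_lam => [//||y]; [exact: measurable_law_mass|rewrite law_mass_ge0 IH].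
by apply: kop_fin_num => [//||y]; [exact: measurable_law_mass|rewrite law_mass_ge0 IH].
Qed.

Lemma tsize_nodeE (cs : seq (ttree unit)) :
  (tsize (TNode tt cs))%:R%:E = 1 + \sum_(c <- cs) (tsize c)%:R%:E :> \bar R.
Proof.
rewrite /= -natr1 EFinD addeC; congr (_ + _).
elim: cs => [|c cs IH] /=; first by rewrite big_nil.
by rewrite big_cons -IH natrD EFinD.
Qed.

(** In [esum_poisson_prod_sum] the weight of a child is [q] and its size is [s]; the root accounts
    for the 1. *)
Lemma law_sizeS b n x :
  law_size b n.+1 x = law_mass b n.+1 x * (1 + K (law_size b n) x).
Proof.
rewrite /law_size (reindex_esum _ _ _ _ TNode_bij).
transitivity (\esum_(cs in [set: seq (ttree unit)]) ((expR (- lam x))%:E *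
   (((size cs)`!%:R^-1)%:E *
    (\big[*%E/1]_(c <- cs) K (fun y => tree_law b n y c) x *
     (1 + \sum_(c <- cs) (tsize c)%:R%:E))))).
  by apply: eq_esum => cs _; rewrite tsize_nodeE [tree_law _ _ _ _]/= EFinM !muleA.
have q0 c : 0 <= K (fun y => tree_law b n y c) x.
  by apply: kop_ge0 => // y; exact: tree_law_ge0.
have E : \esum_(c in setT) K (fun y => tree_law b n y c) x = K (law_mass b n) x.
  rewrite -kop_esum// => [c|c y]; [exact: measurable_tree_law|exact: tree_law_ge0].
have s0 c : 0 <= ((tsize c)%:R : R)%:E by rewrite lee_fin.
rewrite esumZl ?lee_fin ?expR_ge0//; last first.
  by move=> l; rewrite mule_ge0 ?lee_fin// mule_ge0 ?prode_ge0// adde_ge0 ?sume_ge0.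
rewrite esum_poisson_prod_sum//; last first.
  rewrite E; apply: kop_fin_num => //; first exact: measurable_law_mass.
  by move=> y; rewrite law_mass_ge0 law_mass_le1.
rewrite E muleA -EFinM -expRD -law_massS; last by move=> y; exact: law_mass_le1.
congr (_ * (_ + _)); rewrite /= -/(law_size b n) kop_esum//.
apply: eq_esum => t _; rewrite muleC -kopZ//.
- by apply: eq_integral => y _; rewrite (muleC (tree_law _ _ _ _)).
- exact: measurable_tree_law.
- by move=> y; exact: tree_law_ge0.
Qed.

Lemma law_mass_true n x : law_mass true n x = 1.
Proof.
elim: n x => [|n IH] x; first by rewrite law_mass0.
rewrite law_massS; last by move=> y; rewrite IH.
by rewrite (_ : law_mass true n = cst 1) ?lamE//= ?addNr ?expR0//; apply/funext.
Qed.

Lemma law_mass_nd n x : law_mass false n x <= law_mass false n.+1 x.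
Proof.
elim: n x => [|n IH] x; first by rewrite law_mass0 law_mass_ge0.
rewrite !law_massS; try by move=> y; exact: law_mass_le1.
rewrite lee_fin ler_expR lerD2l fine_le//.
- by apply: kop_fin_num => [//||y];
  [exact: measurable_law_mass|rewrite law_mass_ge0 law_mass_le1].
- by apply: kop_fin_num => [//||y];
  [exact: measurable_law_mass|rewrite law_mass_ge0 law_mass_le1].
apply: le_kop => //; try exact: measurable_law_mass; try by move=> y; exact: law_mass_ge0.
by apply: aeW => y.
Qed.

Lemma law_size_nd n x : law_size false n x <= law_size false n.+1 x.
Proof.
elim: n x => [|n IH] x; first by rewrite law_size0 law_size_ge0.
rewrite (law_sizeS _ n) law_sizeS lee_pmul ?law_mass_ge0 ?law_mass_nd//.
  by rewrite adde_ge0// kop_ge0// => y; exact: law_size_ge0.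
rewrite leeD2l//; apply: le_kop => //; try exact: measurable_law_size; try by move=> y;
  exact: law_size_ge0.
by apply: aeW => y.
Qed.

End TreeLaw.

Lemma eq_sup_range {R : realType} (u v : nat -> \bar R) : u =1 v ->
  ereal_sup (range u) = ereal_sup (range v).
Proof. by move=> /funext ->. Qed.

(** * Extinction probability and expected size *)

Section Process.
Context {R : realType} {d : measure_display} {S : measurableType d}.
Variables (mu : probability S R) (kappa : S -> S -> R).
Context {dO : measure_display} {Om : measurableType dO}.
Variables (P : S -> probability Om R) (X : nat -> Om -> ttree S).
Hypothesis Hk : is_kernel mu kappa.
Hypothesis HX : is_branching_process mu kappa P X.
Local Open Scope ereal_scope.

Lemma shape_eventE n t :
  [set w | shape (X n w) = t] = [set w | tmatch (X n w) (full t)].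
Proof. by apply/seteqP; split=> w /=; rewrite tmatch_full. Qed.

Lemma measurable_shape n t : measurable [set w | shape (X n w) = t].
Proof.
rewrite shape_eventE; have [_ H] := HX.
(* The event does not depend on the starting type, so any type serves to extract its
   measurability. *)
by have [] := H point n (full t) (tmeas_full _ _ t).
Qed.

Lemma shape_law n t x :
  P x [set w | shape (X n w) = t] = tree_law mu kappa true n x t.
Proof.
rewrite shape_eventE; have [_ H] := HX.
by have [_ ->] := H x n (full t) (tmeas_full _ _ t); rewrite cyl_prob_full.
Qed.

Lemma measurable_shape_fun n (f : ttree unit -> \bar R) : (forall t, 0 <= f t) ->
  measurable_fun [set: Om] (fun w => f (shape (X n w))).
Proof. by move=> f0; apply: measurable_countable => // t; exact: measurable_shape. Qed.

Lemma integral_shape n x (f : ttree unit -> \bar R) : (forall t, 0 <= f t) ->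
  \int[P x]_w f (shape (X n w)) =
  \esum_(t in [set: ttree unit]) (tree_law mu kappa true n x t * f t).
Proof.
move=> f0; rewrite (integral_countable _ _ _ _ (fun w => shape (X n w)) f)//.
  by apply: eq_esum => t _; rewrite muleC; congr *%E; exact: shape_law.
by move=> t; exact: measurable_shape.
Qed.

Let total : Om -> \bar R := tot X.

Let sz n w : \bar R := ((tsize (X n w))%:R)%:E.
Let szE n w : sz n w = (fun t => ((tsize t)%:R : R)%:E) (shape (X n w)).
Proof. by rewrite /= shape_tsize. Qed.

Let sz0 n w : 0 <= sz n w. Proof. by rewrite lee_fin. Qed.

Let msz n : measurable_fun [set: Om] (sz n).
Proof.
rewrite (_ : sz n = fun w => (fun t => ((tsize t)%:R : R)%:E) (shape (X n w))).
  by apply: (measurable_shape_fun n (fun t => ((tsize t)%:R : R)%:E)) => t; rewrite lee_fin.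
by apply/funext => w; rewrite szE.
Qed.

Let sz_nd n w : sz n w <= sz n.+1 w.
Proof.
by rewrite lee_fin ler_nat; have [H _] := HX; rewrite -H; exact: tsize_trunc.
Qed.

Lemma chiE x : chi P X x = ereal_sup (range (fun n => law_size mu kappa true n x)).
Proof.
rewrite /chi /tot (integral_ereal_sup _ _ (P x) sz)//; apply: eq_sup_range => n;
  rewrite /law_size -integral_shape; last by move=> t; rewrite lee_fin.
by apply: eq_integral => w _; rewrite szE.
Qed.

(** Consistency makes [X n] a truncation of the later trees, and [dead_ttrunc] says that this
    truncation loses nothing. *)
Lemma dead_stable n m w : dead n (X n w) -> (n <= m)%N -> X m w = X n w.
Proof.
have [H _] := HX => dn /subnKC <-; elim: (m - n)%N => [|k IH]; first by rewrite addn0.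
have dk : dead (n + k) (X (n + k) w).
  rewrite IH; elim: {IH} k => [|k IH]; first by rewrite addn0.
  by rewrite addnS; exact: deadS.
rewrite addnS -IH -[in RHS]H; apply/esym/dead_ttrunc; by rewrite H.
Qed.

Let dd n w : \bar R := (dead n (X n w))%:R%:E.
Let ddE n w : dd n w = (fun t => ((dead n t)%:R : R)%:E) (shape (X n w)).
Proof. by rewrite /= shape_dead. Qed.
Let dd0 n w : 0 <= dd n w. Proof. by rewrite lee_fin. Qed.

Let mdd n : measurable_fun [set: Om] (dd n).
Proof.
rewrite (_ : dd n = fun w => (fun t => ((dead n t)%:R : R)%:E) (shape (X n w))).
  by apply: (measurable_shape_fun n (fun t => ((dead n t)%:R : R)%:E)) => t;
    rewrite lee_fin.
by apply/funext => w; rewrite ddE.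
Qed.

Let dd_nd n w : dd n w <= dd n.+1 w.
Proof.
rewrite lee_fin ler_nat; case: (boolP (dead n (X n w))) => // dn.
by rewrite (dead_stable n n.+1)// deadS.
Qed.

Let szdd_nd n w : sz n w * dd n w <= sz n.+1 w * dd n.+1 w.
Proof. by apply: lee_pmul. Qed.

Let tot_dead n w : dead n (X n w) -> total w = sz n w.
Proof.
move=> dn; apply/eqP; rewrite eq_le; apply/andP; split; last first.
  by apply: ereal_sup_ubound; exists n.
apply: ge_ereal_sup => _ [m _ <-].
have [nm|/ltnW mn] := leqP n m; first by rewrite (dead_stable n m).
have : nondecreasing_seq (sz^~ w) by apply/nondecreasing_seqP.
exact.
Qed.

(** Finite total size is extinction: an extinct tree stops growing, and one alive in every
    generation has more than n particles for every n. *)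
Let tot_ltyP w : ((total w < +oo)%E) <-> exists n, dead n (X n w).
Proof.
split=> [|[n dn]]; last by rewrite (tot_dead n)// ltry.
apply: contraPP => /forallNP H; apply/negP; rewrite -leNgt leye_eq.
apply/eqP/eq_infty => t; rewrite /total /tot.
apply: (@le_trans _ _ (sz (Num.truncn t).+1 w)); last first.
  by apply: ereal_sup_ubound; exists (Num.truncn t).+1.
have /negP/tsize_not_dead h := H (Num.truncn t).+1.
rewrite lee_fin (le_trans (ltW (truncnS_gt t)))// ler_nat ltnW//.
Qed.

Let alive_sup w : ((\1_[set w | (total w < +oo)%E] w : R)%:E) = ereal_sup (range (dd^~ w)).
Proof.
have [H|H] := pselect (total w < +oo)%E; rewrite indicE;
  [rewrite mem_set//|rewrite memNset//].
  have [n dn] := (tot_ltyP w).1 H; apply/eqP; rewrite eq_le; apply/andP; split.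
    by apply: ereal_sup_ubound; exists n => //; rewrite /dd dn.
  by apply: ge_ereal_sup => _ [m _ <-]; rewrite lee_fin lern1 leq_b1.
apply/eqP; rewrite eq_le; apply/andP; split.
  by apply: (@le_trans _ _ (dd 0 w)); [exact: dd0|apply: ereal_sup_ubound; exists 0%N].
apply: ge_ereal_sup => _ [m _ <-]; rewrite /dd; case: (boolP (dead m _)) => // dm.
by exfalso; apply: H; apply/tot_ltyP; exists m.
Qed.

Let mtot : measurable [set w | (total w < +oo)%E].
Proof.
suff : measurable_fun [set: Om] (EFin \o (\1_[set w | (total w < +oo)%E] : Om -> R)).
  by move/measurable_EFinP/measurable_indicP.
rewrite (_ : _ \o _ = fun w => ereal_sup (range (dd^~ w))); last first.
  by apply/funext => w; rewrite /= alive_sup.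
apply: (@emeasurable_fun_cvg _ _ _ _ dd) => // w _.
by apply: ereal_nondecreasing_cvgn; apply/nondecreasing_seqP.
Qed.

Let tsize_tree_lawF n x (f : ttree unit -> \bar R) :
  \esum_(t in [set: ttree unit]) (tree_law mu kappa true n x t * (f t * (dead n t)%:R%:E))
  = \esum_(t in [set: ttree unit]) (tree_law mu kappa false n x t * f t).
Proof.
apply: eq_esum => t _; rewrite tree_lawF; case: ifP => _; first by rewrite mule1.
by rewrite mule0 mule0 mul0e.
Qed.

(** The events that generation [n] is empty increase to the event of finite total size, so monotone
    convergence applies to their indicators. *)
Lemma extinctionE x :
  ((1 - rho P X x)%R)%:E = ereal_sup (range (fun n => law_mass mu kappa false n x)).
Proof.
have -> : ((1 - rho P X x)%R)%:E = P x [set w | (total w < +oo)%E].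
  have -> : [set w | (total w < +oo)%E] = ~` [set w | (total w = +oo)%E].
    apply/seteqP; split => w /=; first by move=> + E; rewrite E ltxx.
    by rewrite ltey => /eqP.
  have m' : measurable [set w | (total w = +oo)%E].
    rewrite (_ : [set w | _] = ~` [set w | (total w < +oo)%E]); first exact: measurableC.
    apply/seteqP; split => w /=; first by move=> ->; rewrite ltxx.
    by move/negP; rewrite -leNgt leye_eq => /eqP.
  rewrite probability_setC// EFinB /rho fineK//; exact: fin_num_measure.
rewrite -[in LHS](setIT [set w | _]) -integral_indic//.
under eq_integral do rewrite alive_sup.
rewrite integral_ereal_sup//; apply: eq_sup_range => n.
transitivity (\int[P x]_w (fun t => 1 * ((dead n t)%:R : R)%:E) (shape (X n w))).
  by apply: eq_integral => w _; rewrite ddE mul1e.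
rewrite (integral_shape n x (fun t => 1 * ((dead n t)%:R : R)%:E)); last first.
  by move=> t; rewrite mul1e lee_fin.
by rewrite tsize_tree_lawF; apply: eq_esum => t _; rewrite mule1.
Qed.

(** If generation [n] is empty, [X n] is already the whole tree. Hence size times extinction
    indicator increases to the total size on finite trees and stays 0 on infinite ones. *)
Lemma chihatE x :
  chihat P X x = ereal_sup (range (fun n => law_size mu kappa false n x)).
Proof.
rewrite /chihat integral_mkcond.
transitivity (\int[P x]_w ereal_sup (range (fun n => sz n w * dd n w))).
  apply: eq_integral => w _; rewrite patchE; case: ifPn.
    move=> /set_mem/= /tot_ltyP[n dn]; apply/eqP; rewrite eq_le; apply/andP; split.
      by apply: ereal_sup_ubound; exists n => //;
        rewrite /dd dn mule1 -[tot X w]/(total w) (tot_dead n).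
    apply: ge_ereal_sup => _ [m _ <-]; rewrite -[leRHS]mule1.
    rewrite lee_pmul// ?lee_fin ?lern1 ?leq_b1//.
    by apply: ereal_sup_ubound; exists m.
  rewrite notin_setE => H; apply/eqP; rewrite eq_le; apply/andP; split.
    by apply: ereal_sup_ge; exists (sz 0 w * dd 0 w); [exists 0%N|rewrite mule_ge0].
  apply: ge_ereal_sup => _ [m _ <-]; rewrite /dd; case: (boolP (dead m _)) => // dm.
    by exfalso; apply: H; apply/tot_ltyP; exists m.
  by rewrite mule0.
rewrite (integral_ereal_sup _ _ _ (fun n w => sz n w * dd n w))//; last 2 first.
- by move=> n; exact: emeasurable_funM.
- by move=> n w; exact: mule_ge0.
apply: eq_sup_range => n.
transitivity (\int[P x]_w (fun t => (tsize t)%:R%:E * ((dead n t)%:R : R)%:E) (shape (X n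
    w))).
  by apply: eq_integral => w _; rewrite ddE szE.
rewrite (integral_shape n x (fun t => (tsize t)%:R%:E * ((dead n t)%:R : R)%:E));
  last first.
  by move=> t; rewrite mule_ge0// lee_fin.
by rewrite tsize_tree_lawF.
Qed.

End Process.

(** * Fixed-point equations for extinction and survival *)

Section Fixpoints.
Context {R : realType} {d : measure_display} {S : measurableType d}.
Variables (mu : probability S R) (kappa : S -> S -> R).
Context {dO : measure_display} {Om : measurableType dO}.
Variables (P : S -> probability Om R) (X : nat -> Om -> ttree S).
Hypothesis Hk : is_kernel mu kappa.
Hypothesis HX : is_branching_process mu kappa P X.
Local Open Scope ereal_scope.
Local Notation K := (kop mu kappa).
Local Notation w x := ((1 - rho P X x)%R).

Let mass := law_mass mu kappa false.
Let mass0 n x : 0 <= mass n x. Proof. exact: law_mass_ge0. Qed.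
Let mass1 n x : mass n x <= 1. Proof. exact: law_mass_le1. Qed.
Let mass_nd n x : mass n x <= mass n.+1 x. Proof. exact: law_mass_nd. Qed.
Let mmass n : measurable_fun [set: S] (mass n). Proof. exact: measurable_law_mass. Qed.

Lemma extinction_ge0 x : (0 <= w x)%R.
Proof.
rewrite -lee_fin (extinctionE _ _ _ _ HX).
by apply: (le_trans (mass0 0 x)); apply: ereal_sup_ubound; exists 0%N.
Qed.

Lemma extinction_le1 x : (w x <= 1)%R.
Proof.
rewrite -lee_fin (extinctionE _ _ _ _ HX).
by apply: ge_ereal_sup => _ [n _ <-]; exact: mass1.
Qed.

Lemma rho_ge0 x : (0 <= rho P X x)%R.
Proof. by have := extinction_le1 x; rewrite gerBl. Qed.

Lemma rho_le1 x : (rho P X x <= 1)%R.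
Proof. by have := extinction_ge0 x; rewrite subr_ge0. Qed.

Lemma extinction_cvg x : mass n x @[n --> \oo] --> (w x)%:E.
Proof.
rewrite (extinctionE _ _ _ _ HX).
by apply: ereal_nondecreasing_cvgn; apply/nondecreasing_seqP => n; exact: mass_nd.
Qed.

Lemma measurable_extinction : measurable_fun [set: S] (fun x => w x).
Proof.
apply/measurable_EFinP; apply: (emeasurable_fun_cvg _ _ mmass) => x _.
exact: extinction_cvg.
Qed.

Lemma measurable_rho : measurable_fun [set: S] (rho P X).
Proof.
rewrite (_ : rho P X = fun x => (1 - w x)%R).
  by apply: measurable_funB => //; exact: measurable_extinction.
by apply/funext => x; rewrite subKr.
Qed.

Lemma extinction_fixpoint x :
  w x = expR (- lam mu kappa x + fine (K (fun y => (w y)%:E) x)).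
Proof.
have Kfin h : measurable_fun [set: S] h -> (forall y, 0 <= h y <= 1) -> K h x \is a fin_num.
  exact: kop_fin_num.
have cvK : K (mass n) x @[n --> \oo] --> K (fun y => (w y)%:E) x.
  rewrite (_ : (fun y => (w y)%:E) = fun y => ereal_sup (range (mass^~ y))); last first.
    by apply/funext => y; rewrite (extinctionE _ _ _ _ HX).
  rewrite kop_sup//; apply: ereal_nondecreasing_cvgn; apply/nondecreasing_seqP => n.
  by apply: le_kop => //; apply: aeW => y; exact: mass_nd.
have fK : fine (K (mass n) x) @[n --> \oo] --> fine (K (fun y => (w y)%:E) x).
  apply: fine_cvg; rewrite fineK//; apply: Kfin.
    by apply/measurable_EFinP; exact: measurable_extinction.
  by move=> y; rewrite !lee_fin extinction_ge0 extinction_le1.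
have c1 : mass n.+1 x @[n --> \oo] -->
    (expR (- lam mu kappa x + fine (K (fun y => (w y)%:E) x)))%:E.
  under eq_fun do rewrite /mass law_massS//.
  apply: cvg_EFin; first exact: nearW.
  have cD : (- lam mu kappa x + fine (K (mass n) x))%R @[n --> \oo] -->
      (- lam mu kappa x + fine (K (fun y => (w y)%:E) x))%R.
    by apply: cvgD => //; exact: cvg_cst.
  exact: (cvg_comp _ _ cD (@continuous_expR R _)).
have c2 : mass n.+1 x @[n --> \oo] --> (w x)%:E.
  by rewrite (cvg_shiftS (mass^~ x)); exact: extinction_cvg.
by apply: EFin_inj; rewrite -(cvg_lim _ c2)// -(cvg_lim _ c1).
Qed.

(** The offspring intensity is finite at every type, so survival is never certain; thus [mu] and the
    measure with density [1 - rho] have the same null sets. *)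
Lemma extinction_gt0 x : (0 < w x)%R.
Proof. by rewrite extinction_fixpoint expR_gt0. Qed.

(** The images under [K] of [rho] and [1 - rho] add up to [lam], and both are finite. *)
Lemma extinction_rho x : w x = expR (- fine (K (fun y => (rho P X y)%:E) x)).
Proof.
rewrite extinction_fixpoint; congr expR.
have H (h : S -> R) : measurable_fun [set: S] h -> (forall y, (0 <= h y <= 1)%R) ->
   K (EFin \o h) x \is a fin_num.
  move=> mh h01; apply: kop_fin_num => //; exact/measurable_EFinP.
have fr : K (fun y => (rho P X y)%:E) x \is a fin_num.
  by apply: H => [|y]; [exact: measurable_rho|rewrite rho_ge0 rho_le1].
have fw : K (fun y => (w y)%:E) x \is a fin_num.
  by apply: H => [|y]; [exact: measurable_extinction|rewrite extinction_ge0 extinction_le1].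
apply/eqP; rewrite addrC subr_eq addrC -subr_eq opprK -fineD//; apply/eqP.
rewrite -ge0_integralD//.
- rewrite -[RHS]/(fine (lam mu kappa x)%:E) -lamE//; congr fine.
  by apply: eq_integral => y _; rewrite -muleDr// -EFinD subrK.
- move=> y _; apply: (kop_integrand_ge0 _ _ Hk (fun y => (w y)%:E)) => z.
  by rewrite lee_fin extinction_ge0.
- apply: (kop_integrand_meas _ _ Hk (fun y => (w y)%:E)); apply/measurable_EFinP.
  exact: measurable_extinction.
- move=> y _; apply: (kop_integrand_ge0 _ _ Hk (fun y => (rho P X y)%:E)) => z.
  by rewrite lee_fin rho_ge0.
- apply: (kop_integrand_meas _ _ Hk (fun y => (rho P X y)%:E)); apply/measurable_EFinP.
  exact: measurable_rho.
Qed.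

(** The probability that generation [n] is not empty; it decreases from 1 to [rho] and replaces
    [rho] as Schur test function when [rho] vanishes. *)
Definition survival n x : R := (1 - fine (mass n x))%R.

Let mass_fin n x : mass n x \is a fin_num.
Proof. by rewrite ge0_fin_numE// (le_lt_trans (mass1 n x))// ltry. Qed.

Lemma survival_ge0 n x : (0 <= survival n x)%R.
Proof. by rewrite subr_ge0 -lee_fin fineK. Qed.

Lemma survival_le1 n x : (survival n x <= 1)%R.
Proof. by rewrite gerBl fine_ge0. Qed.

Lemma measurable_survival n : measurable_fun [set: S] (survival n).
Proof. by apply: measurable_funB => //; apply: measurableT_comp. Qed.

Lemma survival0 x : survival 0 x = 1%R.
Proof. by rewrite /survival /mass law_mass0// subr0. Qed.

Lemma survival_ni n x : (survival n.+1 x <= survival n x)%R.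
Proof. by rewrite lerD2l lerN2 fine_le. Qed.

Lemma survival_cvg x : survival n x @[n --> \oo] --> rho P X x.
Proof.
rewrite -(subKr 1%R (rho P X x)); apply: cvgB; first exact: cvg_cst.
by apply: fine_cvg; exact: extinction_cvg.
Qed.

Lemma survivalS n x :
  survival n.+1 x = (1 - expR (- fine (K (fun y => (survival n y)%:E) x)))%R.
Proof.
rewrite {1}/survival /mass law_massS//; congr (1 - expR _)%R.
have fr : K (fun y => (survival n y)%:E) x \is a fin_num.
  apply: kop_fin_num => //; first by apply/measurable_EFinP; exact: measurable_survival.
  by move=> y; rewrite !lee_fin survival_ge0 survival_le1.
have fw : K (mass n) x \is a fin_num by apply: kop_fin_num => // y; rewrite mass0 mass1.
apply/eqP; rewrite addrC subr_eq addrC -subr_eq opprK -fineD//; apply/eqP.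
rewrite -ge0_integralD//.
- rewrite -[RHS]/(fine (lam mu kappa x)%:E) -lamE//; congr fine.
  apply: eq_integral => y _; rewrite -[law_mass _ _ _ _ _]fineK//.
  by rewrite -muleDr// -EFinD subrKC.
- by move=> y _; apply: (kop_integrand_ge0 _ _ Hk (mass n)).
- exact: (kop_integrand_meas _ _ Hk (mass n)).
- move=> y _; apply: (kop_integrand_ge0 _ _ Hk (fun y => (survival n y)%:E)) => z.
  by rewrite lee_fin survival_ge0.
- apply: (kop_integrand_meas _ _ Hk (fun y => (survival n y)%:E)); apply/measurable_EFinP.
  exact: measurable_survival.
Qed.

End Fixpoints.

Lemma sup_range_cvg {R : realType} (u : nat -> \bar R) (l : \bar R) :
  (forall n, (u n <= u n.+1)%E) -> u n @[n --> \oo] --> l -> ereal_sup (range u) = l.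
Proof.
move=> nd ul; have : u n @[n --> \oo] --> ereal_sup (range u).
  by apply: ereal_nondecreasing_cvgn; apply/nondecreasing_seqP.
by move=> /cvg_lim <-//; apply: cvg_lim.
Qed.

Lemma cvg_sup_range {R : realType} (u : nat -> \bar R) :
  (forall n, (u n <= u n.+1)%E) -> u n @[n --> \oo] --> ereal_sup (range u).
Proof. by move=> nd; apply: ereal_nondecreasing_cvgn; apply/nondecreasing_seqP. Qed.

Lemma poweR_half_le {R : realType} (x : \bar R) (c : R) : (0 <= x)%E -> 0 <= c ->
  (poweR x (2^-1) <= c%:E)%E = (x <= (c ^+ 2)%:E)%E.
Proof.
case: x => [x| |] //; last by rewrite poweRyr ?invr_eq0.
move=> x0 c0; rewrite poweR_EFin !lee_fin powR12_sqrt//.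
by rewrite -[X in (_ <= X)%R = _](ger0_norm c0) -sqrtr_sqr ler_sqrt// exprn_ge0.
Qed.

(** * Neumann series of the weighted operator *)

Section Weighted.
Context {R : realType} {d : measure_display} {S : measurableType d}.
Variables (mu : probability S R) (kappa : S -> S -> R).
Hypothesis Hk : is_kernel mu kappa.
Variable w : S -> R.
Hypothesis mw : measurable_fun [set: S] w.
Hypothesis w_gt0 : forall x, 0 < w x.
Hypothesis w_le1 : forall x, w x <= 1.
Local Open Scope ereal_scope.
Local Notation K := (kop mu kappa).

Definition wkop (F : S -> \bar R) : S -> \bar R := K (fun y => (w y)%:E * F y).
(** The square of [wnorm2]; working with squares avoids the root and any triangle inequality. *)
Definition wsq (F : S -> \bar R) : \bar R := \int[mu]_x ((w x)%:E * (F x * F x)).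

Let w_ge0 x : (0 <= w x)%R. Proof. exact: ltW. Qed.
Let mwE : measurable_fun [set: S] (EFin \o w). Proof. exact/measurable_EFinP. Qed.

Lemma TopE (f : S -> R) : Top mu kappa w f = wkop (EFin \o f).
Proof.
apply/funext => x; apply: eq_integral => y _.
by rewrite -mulrA EFinM /= (mulrC (f y)) EFinM.
Qed.

Lemma wmul_meas (F : S -> \bar R) : measurable_fun [set: S] F ->
  measurable_fun [set: S] (fun y => (w y)%:E * F y).
Proof. by move=> mF; exact: emeasurable_funM. Qed.

Lemma wmul_ge0 (F : S -> \bar R) : (forall x, 0 <= F x) ->
  forall y, 0 <= (w y)%:E * F y.
Proof. by move=> F0 y; rewrite mule_ge0// lee_fin. Qed.

Lemma wkop_meas (F : S -> \bar R) : measurable_fun [set: S] F ->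
  (forall x, 0 <= F x) -> measurable_fun [set: S] (wkop F).
Proof.
by move=> mF F0; apply: kop_meas => //; [exact: wmul_meas|exact: wmul_ge0].
Qed.

Lemma wkop_ge0 (F : S -> \bar R) x : (forall x, 0 <= F x) -> 0 <= wkop F x.
Proof. by move=> F0; apply: kop_ge0 => //; exact: wmul_ge0. Qed.

Lemma le_wkop (F G : S -> \bar R) x : measurable_fun [set: S] F ->
  measurable_fun [set: S] G -> (forall x, 0 <= F x) -> (forall x, 0 <= G x) ->
  {ae mu, forall y, F y <= G y} -> wkop F x <= wkop G x.
Proof.
move=> mF mG F0 G0 FG; apply: le_kop => //.
- exact: wmul_meas.
- exact: wmul_meas.
- exact: wmul_ge0.
- by apply: filterS FG => y FG; rewrite lee_wpmul2l// lee_fin.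
- exact: wmul_ge0.
Qed.

Lemma wkopZ (F : S -> \bar R) (k : \bar R) x : measurable_fun [set: S] F ->
  (forall x, 0 <= F x) -> 0 <= k -> wkop (fun y => k * F y) x = k * wkop F x.
Proof.
move=> mF F0 k0; rewrite /wkop -kopZ//; [|exact: wmul_meas|exact: wmul_ge0].
by apply: eq_integral => y _; rewrite (muleCA (w y)%:E).
Qed.

Lemma wsq_int_meas (F : S -> \bar R) : measurable_fun [set: S] F ->
  measurable_fun [set: S] (fun x => (w x)%:E * (F x * F x)).
Proof. by move=> mF; apply: wmul_meas; exact: emeasurable_funM. Qed.

Lemma sqe_ge0 (x : \bar R) : 0 <= x * x.
Proof.
by have [x0|/ltW x0] := leP 0 x; [exact: mule_ge0|exact: mule_le0].
Qed.

Lemma wsq_int_ge0 (F : S -> \bar R) x : 0 <= (w x)%:E * (F x * F x).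
Proof. by rewrite mule_ge0 ?lee_fin// sqe_ge0. Qed.

Lemma wsq_ge0 (F : S -> \bar R) : 0 <= wsq F.
Proof. by apply: integral_ge0 => x _; exact: wsq_int_ge0. Qed.

Lemma le_wsq (F G : S -> \bar R) : measurable_fun [set: S] F ->
  measurable_fun [set: S] G -> (forall x, 0 <= F x) ->
  {ae mu, forall y, F y <= G y} -> wsq F <= wsq G.
Proof.
move=> mF mG F0 FG; apply: ae_ge0_le_integral => //.
- by move=> x _; exact: wsq_int_ge0.
- exact: wsq_int_meas.
- by move=> x _; exact: wsq_int_ge0.
- exact: wsq_int_meas.
- by apply: filterS FG => y FG _; rewrite lee_wpmul2l ?lee_fin// lee_pmul.
Qed.

Lemma wsqZ (F : S -> \bar R) (k : R) : measurable_fun [set: S] F ->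
  wsq (fun x => k%:E * F x) = (k ^+ 2)%:E * wsq F.
Proof.
move=> mF; rewrite /wsq -ge0_integralZl//.
- apply: eq_integral => x _; rewrite expr2 EFinM.
  by rewrite [RHS]muleCA; congr *%E; exact: muleACA.
- exact: wsq_int_meas.
- by move=> x _; exact: wsq_int_ge0.
- by rewrite lee_fin sqr_ge0.
Qed.

(** As [w] is positive, the integrand is infinite wherever [F] is. *)
Lemma ae_wsq_fin (F : S -> \bar R) : measurable_fun [set: S] F ->
  (forall x, 0 <= F x) -> wsq F < +oo -> {ae mu, forall x, F x \is a fin_num}.
Proof.
move=> mF F0 Foo.
have : mu.-integrable [set: S] (fun x => (w x)%:E * (F x * F x)).
  apply/integrableP; split; first exact: wsq_int_meas.
  by under eq_integral do rewrite gee0_abs ?wsq_int_ge0//.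
move=> /(integrable_ae measurableT); apply: filterS => x /(_ I).
rewrite !ge0_fin_numE ?wsq_int_ge0//; case: (F x) => [r _| |//]; first exact: ltry.
by rewrite mulyy gt0_muley// lte_fin.
Qed.

Lemma wkop_fine (F : S -> \bar R) x : measurable_fun [set: S] F ->
  (forall x, 0 <= F x) -> {ae mu, forall x, F x \is a fin_num} ->
  wkop (fun y => (fine (F y))%:E) x = wkop F x.
Proof.
move=> mF F0 fF; have mf : measurable_fun [set: S] (fun y => (fine (F y))%:E).
  by apply/measurable_EFinP; exact: measurableT_comp.
have f0 y : 0 <= (fine (F y))%:E by rewrite lee_fin fine_ge0.
by apply/eqP; rewrite eq_le !le_wkop//; apply: filterS fF => y /fineK ->.
Qed.

Lemma opnorm_ge0 : 0 <= opnorm mu kappa w.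
Proof.
apply: ereal_sup_ge; exists (wnorm2 mu w (Top mu kappa w (cst 0%R))); last exact: poweR_ge0.
exists (cst 0%R) => //; split => //.
rewrite /wnorm2; under eq_integral do rewrite mule0 mule0.
by rewrite integral0 poweR0r ?lee_fin ?invr_eq0.
Qed.

(** [opnorm] tests real functions in the unit ball only, so [F] is replaced by its a.e. equal finite
    part and divided by the root of [c], whence [c > 0]. *)
Lemma opnorm_bound (t c : R) (F : S -> \bar R) : (0 <= t)%R -> (0 < c)%R ->
  opnorm mu kappa w <= t%:E -> measurable_fun [set: S] F -> (forall x, 0 <= F x) ->
  wsq F <= c%:E -> wsq (wkop F) <= (t ^+ 2 * c)%:E.
Proof.
move=> t0 c0 opt mF F0 Fc.
have fF : {ae mu, forall x, F x \is a fin_num}.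
  by apply: ae_wsq_fin => //; rewrite (le_lt_trans Fc)// ltry.
have sc0 : (0 <= (Num.sqrt c)^-1)%R by rewrite invr_ge0 sqrtr_ge0.
pose f x := ((Num.sqrt c)^-1 * fine (F x))%R.
have mfF : measurable_fun [set: S] (fine \o F) by exact: measurableT_comp.
have mf : measurable_fun [set: S] f by apply: measurable_funM.
have f0 x : (0 <= f x)%R by rewrite mulr_ge0// fine_ge0.
have fE : wsq (EFin \o f) <= 1.
  rewrite (_ : EFin \o f = fun x => (Num.sqrt c)^-1%:E * (fine (F x))%:E); last first.
    by apply/funext => x; rewrite /f /= EFinM.
  rewrite wsqZ; last exact/measurable_EFinP.
  rewrite exprVn sqr_sqrtr ?(ltW c0)//.
  have -> : 1 = c^-1%:E * c%:E by rewrite -EFinM mulVf// gt_eqF.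
  rewrite lee_wpmul2l ?lee_fin ?invr_ge0 ?(ltW c0)//.
  apply: le_trans Fc; apply: le_wsq => //.
  + exact/measurable_EFinP.
  + by move=> x; rewrite lee_fin fine_ge0.
  + by apply: filterS fF => x /fineK ->.
have : wnorm2 mu w (Top mu kappa w f) <= t%:E.
  apply: le_trans opt; apply: ereal_sup_ubound; exists f => //; split => //.
  by rewrite poweR_half_le ?expr1n ?ler01//; exact: wsq_ge0.
rewrite poweR_half_le//; last exact: wsq_ge0.
rewrite TopE -/(wsq _).
rewrite (_ : wkop (EFin \o f) = fun x => (Num.sqrt c)^-1%:E * wkop F x); last first.
  apply/funext => x; rewrite -(wkop_fine F)// -wkopZ//.
  - by apply/measurable_EFinP.
  - by move=> y; rewrite lee_fin fine_ge0.
rewrite wsqZ; last exact: wkop_meas.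
rewrite exprVn sqr_sqrtr ?(ltW c0)// muleC -lee_pdivlMr ?invr_gt0//.
by rewrite invrK EFinM.
Qed.

Fixpoint neumann (n : nat) (x : S) : \bar R :=
  if n is n'.+1 then 1 + wkop (neumann n') x else 0.

(** The least nonnegative measurable solution of [F = 1 + wkop F], possibly infinite, and meaningful
    without a norm bound. *)
Definition resolvent (x : S) : \bar R := ereal_sup (range (neumann^~ x)).

Lemma neumann_ge0 n x : 0 <= neumann n x.
Proof. by elim: n x => // n IH x; rewrite /= adde_ge0// wkop_ge0. Qed.

Lemma measurable_neumann n : measurable_fun [set: S] (neumann n).
Proof.
elim: n => [|n IH] //=; apply: emeasurable_funD => //.
by apply: wkop_meas => // x; exact: neumann_ge0.
Qed.

Lemma neumann_nd n x : neumann n x <= neumann n.+1 x.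
Proof.
elim: n x => [|n IH] x; first exact: neumann_ge0.
rewrite leeD2l// -/(neumann n.+1) le_wkop//.
- exact: measurable_neumann.
- exact: measurable_neumann.
- by move=> y; exact: neumann_ge0.
- by move=> y; exact: neumann_ge0.
- exact: aeW.
Qed.

Lemma neumann_cvg x : neumann n x @[n --> \oo] --> resolvent x.
Proof. by apply: cvg_sup_range => n; exact: neumann_nd. Qed.

Lemma measurable_resolvent : measurable_fun [set: S] resolvent.
Proof.
apply: (emeasurable_fun_cvg _ _ measurable_neumann) => x _; exact: neumann_cvg.
Qed.

Lemma resolvent_ge0 x : 0 <= resolvent x.
Proof. by apply: ereal_sup_ubound; exists 0%N. Qed.

Lemma wneumann_nd n y : (w y)%:E * neumann n y <= (w y)%:E * neumann n.+1 y.
Proof. by rewrite lee_wpmul2l ?lee_fin// neumann_nd. Qed.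

Lemma wneumann_sup x :
  ereal_sup (range (fun n => (w x)%:E * neumann n x)) = (w x)%:E * resolvent x.
Proof.
apply: sup_range_cvg => [n|]; first exact: wneumann_nd.
by apply: cvgeZl => //; exact: neumann_cvg.
Qed.

Lemma wkop_resolvent_cvg x : wkop (neumann n) x @[n --> \oo] --> wkop resolvent x.
Proof.
rewrite [X in _ --> X](_ : _ = ereal_sup (range (fun n => wkop (neumann n) x))).
  apply: cvg_sup_range => n; apply: le_wkop.
  - exact: measurable_neumann.
  - exact: measurable_neumann.
  - by move=> y; exact: neumann_ge0.
  - by move=> y; exact: neumann_ge0.
  - by apply: aeW => y; exact: neumann_nd.
rewrite -kop_sup//.
- by apply: eq_integral => y _; rewrite wneumann_sup.
- by move=> n; apply: wmul_meas; exact: measurable_neumann.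
- by move=> n; apply: wmul_ge0; exact: neumann_ge0.
- by move=> n y; exact: wneumann_nd.
Qed.

Lemma resolvent_fixpoint x : resolvent x = 1 + wkop resolvent x.
Proof.
have c1 : neumann n.+1 x @[n --> \oo] --> 1 + wkop resolvent x.
  apply: cvgeD; [|exact: cvg_cst|exact: wkop_resolvent_cvg].
  by apply: ge0_adde_def; rewrite inE// wkop_ge0// => y; exact: resolvent_ge0.
have c2 : neumann n.+1 x @[n --> \oo] --> resolvent x.
  by rewrite (cvg_shiftS (neumann^~ x)); exact: neumann_cvg.
by rewrite -(cvg_lim _ c2)// -(cvg_lim _ c1).
Qed.

Lemma resolvent_ge1 x : 1 <= resolvent x.
Proof.
by rewrite resolvent_fixpoint leeDl// wkop_ge0// => y; exact: resolvent_ge0.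
Qed.

(* With [e] such that [(1 + e) ||T||^2 < 1], this replaces Minkowski's inequality
   in bounding the partial sums of the Neumann series. *)
Lemma sq1D_le (e : R) (x : \bar R) : (0 < e)%R -> 0 <= x ->
  (1 + x) * (1 + x) <= (1 + e^-1)%:E + (1 + e)%:E * (x * x).
Proof.
move=> e0; case: x => [x| |//]; last first.
  by rewrite [1 + +oo]addey// mulyy gt0_muley ?lte_fin ?addr_gt0// addey.
rewrite !lee_fin => x0.
have e1 : (e * e^-1 = 1)%R by rewrite mulfV// gt_eqF.
have e2 : (0 < e^-1)%R by rewrite invr_gt0.
have -> : ((1 + e^-1 + (1 + e) * (x * x)) = (1 + x) * (1 + x) + e^-1 * (1 - e * x) * (1 -
    e * x))%R.
  have : (e^-1 * (1 - e * x) * (1 - e * x) = e^-1 - 2 * x * (e * e^-1) + x * x * e * (e *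
      e^-1))%R by ring.
  by rewrite e1 => ->; ring.
by rewrite lerDl -mulrA -expr2 mulr_ge0 ?sqr_ge0// ltW.
Qed.

Hypothesis opnorm_lt1 : opnorm mu kappa w < 1.

Lemma opnorm_real : exists t : R, [/\ (0 <= t)%R, (t < 1)%R & opnorm mu kappa w <= t%:E].
Proof.
have := opnorm_ge0; move: opnorm_lt1; case: (opnorm mu kappa w) => [t| |] //.
by move=> t1 t0; exists t.
Qed.

Lemma wsq_one_le : \int[mu]_x (w x)%:E <= 1.
Proof.
rewrite -(@probability_setT _ _ _ mu) -[leRHS]mul1e -integral_cst//.
apply: ge0_le_integral => // x _; rewrite lee_fin//.
Qed.

Lemma neumann_wsq_bounded : exists2 C : R, (0 < C)%R & forall n, wsq (neumann n) <= C%:E.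
Proof.
have [t [t0 t1 opt]] := opnorm_real.
have [e [e0 et]] : exists e : R, (0 < e /\ (1 + e) * t ^+ 2 < 1)%R.
  (* The choice e = 1 - t makes 1 - (1 + e) t^2 factor with 1 - t, which shows its sign. *)
  exists (1 - t)%R; split; first by rewrite subr_gt0.
  rewrite -subr_gt0.
  have -> : (1 - (1 + (1 - t)) * t ^+ 2 = (1 - t) * (1 + t * (1 - t)))%R by ring.
  have : (0 <= t * (1 - t))%R by rewrite mulr_ge0// subr_ge0 ltW.
  by move=> h; rewrite mulr_gt0 ?subr_gt0//; lra.
(* [C] is the fixed point of c = (1 + 1/e) + (1 + e) t^2 c, the recursion obeyed by the bounds. *)
pose C := ((1 + e^-1) / (1 - (1 + e) * t ^+ 2))%R.
have ei : (0 < e^-1)%R by rewrite invr_gt0.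
have C0 : (0 < C)%R by rewrite divr_gt0 ?subr_gt0//; lra.
exists C => //; elim=> [|n IH].
  rewrite /wsq /=; under eq_integral do rewrite mule0 mule0.
  by rewrite integral0 lee_fin ltW.
have mn := measurable_neumann n.
have n0 := neumann_ge0 n.
have mk : measurable_fun [set: S] (wkop (neumann n)) by exact: wkop_meas.
have IHk := opnorm_bound t C _ t0 C0 opt mn n0 IH.
apply: (@le_trans _ _ (\int[mu]_x ((1 + e^-1)%:E * (w x)%:E +
    (1 + e)%:E * ((w x)%:E * (wkop (neumann n) x * wkop (neumann n) x))))).
  apply: ge0_le_integral => //.
  - by move=> x _; exact: wsq_int_ge0.
  - apply: wsq_int_meas; exact: (measurable_neumann n.+1).
  - apply: emeasurable_funD; apply: measurable_funeM => //; exact: wsq_int_meas.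
  - move=> x _; rewrite (muleC (1 + e^-1)%:E) (muleCA (1 + e)%:E) -ge0_muleDr.
    + by rewrite lee_wpmul2l ?lee_fin// sq1D_le// wkop_ge0.
    + by rewrite lee_fin; lra.
    + by rewrite mule_ge0 ?sqe_ge0// lee_fin; lra.
rewrite ge0_integralD//; last 4 first.
- by move=> x _; rewrite mule_ge0 ?lee_fin//; lra.
- exact: measurable_funeM.
- by move=> x _; rewrite mule_ge0 ?wsq_int_ge0// lee_fin; lra.
- apply: measurable_funeM; exact: wsq_int_meas.
rewrite !ge0_integralZl//; last 5 first.
- exact: wsq_int_meas.
- by move=> x _; exact: wsq_int_ge0.
- by rewrite lee_fin; lra.
- by move=> x _; rewrite lee_fin.
- by rewrite lee_fin; lra.
have -> : C%:E = (1 + e^-1)%:E * 1 + (1 + e)%:E * (t ^+ 2 * C)%:E.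
  rewrite mule1 -EFinM -EFinD; congr EFin.
  have : (C * (1 - (1 + e) * t ^+ 2) = 1 + e^-1)%R by rewrite divfK// gt_eqF// subr_gt0.
  lra.
by rewrite leeD// lee_wpmul2l ?wsq_one_le// lee_fin; lra.
Qed.

Lemma resolvent_wsq : wsq resolvent < +oo.
Proof.
have [C C0 HC] := neumann_wsq_bounded.
rewrite (@le_lt_trans _ _ C%:E)// ?ltry//.
rewrite /wsq.
have E x : (w x)%:E * (resolvent x * resolvent x) =
    ereal_sup (range (fun n => (w x)%:E * (neumann n x * neumann n x))).
  apply/esym/sup_range_cvg => [n|].
    by rewrite lee_wpmul2l ?lee_fin// lee_pmul ?neumann_ge0// neumann_nd.
  apply: cvgeZl => //; apply: cvgeM; [|exact: neumann_cvg|exact: neumann_cvg].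
  have r0 : 0 < resolvent x by rewrite (lt_le_trans _ (resolvent_ge1 x))// lte01.
  by apply: neq0_mule_def; rewrite gt_eqF// mule_gt0.
under eq_integral do rewrite E.
rewrite integral_ereal_sup.
- by apply: ge_ereal_sup => _ [n _ <-]; exact: HC.
- by move=> n; apply: wsq_int_meas; exact: measurable_neumann.
- by move=> n x; exact: wsq_int_ge0.
- by move=> n x; rewrite lee_wpmul2l ?lee_fin// lee_pmul ?neumann_ge0// neumann_nd.
Qed.

Lemma resolvent_fin : {ae mu, forall x, resolvent x \is a fin_num}.
Proof.
apply: ae_wsq_fin => //; [exact: measurable_resolvent|exact: resolvent_ge0|].
exact: resolvent_wsq.
Qed.

Lemma wsq_sub_lty (g h : S -> R) : measurable_fun [set: S] g ->
  measurable_fun [set: S] h -> wsq (EFin \o g) < +oo -> wsq (EFin \o h) < +oo ->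
  wsq (fun x => (`|g x - h x|%R)%:E) < +oo.
Proof.
move=> mg mh gf hf.
apply: (@le_lt_trans _ _ (2%:E * wsq (EFin \o g) + 2%:E * wsq (EFin \o h))); last first.
  by apply: lte_add_pinfty; apply: lte_mul_pinfty => //; rewrite lee_fin.
have mgE : measurable_fun [set: S] (EFin \o g) by exact/measurable_EFinP.
have mhE : measurable_fun [set: S] (EFin \o h) by exact/measurable_EFinP.
rewrite /wsq -!ge0_integralZl//; try (by move=> x _; exact: wsq_int_ge0);
  try exact: wsq_int_meas; try by rewrite lee_fin.
rewrite -ge0_integralD//; try (by move=> x _; rewrite mule_ge0 ?wsq_int_ge0// lee_fin);
  try by apply: measurable_funeM; exact: wsq_int_meas.
apply: ge0_le_integral => //.
- by move=> x _; exact: (wsq_int_ge0 (fun x => (`|g x - h x|%R)%:E)).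
- apply: (wsq_int_meas (fun x => (`|g x - h x|%R)%:E)); apply/measurable_EFinP.
  by apply: measurableT_comp => //; exact: measurable_funB.
- by apply: emeasurable_funD; apply: measurable_funeM; exact: wsq_int_meas.
- move=> x _ /=; rewrite -!EFinM -EFinD lee_fin -normrM -expr2 ger0_norm ?sqr_ge0//.
  have := w_ge0 x; have := sqr_ge0 (g x + h x).
  move=> a b; have : (0 <= w x * (g x + h x) ^+ 2)%R by rewrite mulr_ge0.
  rewrite !expr2; lra.
Qed.

(** For a signed [g] the integral is a difference of two nonnegative ones; in the extended reals it
    is finite only if both are. *)
Lemma integrable_kernel_of_fin (g : S -> R) x : measurable_fun [set: S] g ->
  Top mu kappa w g x \is a fin_num ->
  mu.-integrable [set: S] (EFin \o (fun y => kappa x y * g y * w y)%R).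
Proof.
move=> mg gfin.
have mi : measurable_fun [set: S] (EFin \o (fun y => kappa x y * g y * w y)%R).
  apply/measurable_EFinP; apply: measurable_funM => //; apply: measurable_funM => //.
  exact: (measurable_kernel_snd _ _ Hk).
apply/integrableP; split => //.
by move: gfin; rewrite /Top -integral_fin_num_abs//; exact/measurable_EFinP.
Qed.

(** The difference k = |g - h| satisfies k <= T k, so its squared norm is at most t^2 times itself
    with t < 1. Taking absolute values brings signed solutions back to the nonnegative functions on
    which [opnorm] is defined. *)
Lemma fixpoint_unique (g h : S -> R) : measurable_fun [set: S] g ->
  measurable_fun [set: S] h -> wsq (EFin \o g) < +oo -> wsq (EFin \o h) < +oo ->
  {ae mu, forall x, (g x)%:E = 1 + Top mu kappa w g x} ->
  {ae mu, forall x, (h x)%:E = 1 + Top mu kappa w h x} ->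
  {ae mu, forall x, g x = h x}.
Proof.
move=> mg mh gf hf Eg Eh.
pose k x := (`|g x - h x|%R)%:E.
have mk : measurable_fun [set: S] k.
  by apply/measurable_EFinP; apply: measurableT_comp => //; exact: measurable_funB.
have k0 x : 0 <= k x by rewrite lee_fin.
have kf : wsq k < +oo by exact: wsq_sub_lty.
have kK : {ae mu, forall x, k x <= wkop k x}.
  apply: filterS2 Eg Eh => x Egx Ehx.
  (* The equation itself, having a real left side, certifies that the integral in [Top] is
     finite. *)
  have fin (f : S -> R) : (f x)%:E = 1 + Top mu kappa w f x -> Top mu kappa w f x \is a
      fin_num.
    by case: (Top mu kappa w f x).
  have ig := integrable_kernel_of_fin g x mg (fin _ Egx).
  have ih := integrable_kernel_of_fin h x mh (fin _ Ehx).
  have E : ((g x - h x)%R)%:E = \int[mu]_y ((kappa x y * g y * w y - kappa x y * h y * w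
      y)%R)%:E.
    rewrite integralB_EFin// EFinB Egx Ehx -/(Top mu kappa w g x) -/(Top mu kappa w h x).
    by move: (fin _ Egx) (fin _ Ehx); case: (Top mu kappa w g x) => // a;
      case: (Top mu kappa w h x) => // b _ _; rewrite -!EFinD; congr EFin; ring.
  rewrite /k -abse_EFin E.
  apply: (le_trans (le_abse_integral _ _ _)) => //.
    by apply: (measurable_int mu); have := integrableB measurableT ig ih.
  rewrite le_eqVlt; apply/orP; left; apply/eqP; apply: eq_integral => y _.
  rewrite abse_EFin -!EFinM; congr EFin.
  have -> : (kappa x y * g y * w y - kappa x y * h y * w y = kappa x y * (w y * (g y - h
      y)))%R by ring.
  by rewrite !normrM (ger0_norm (w_ge0 y)) ger0_norm// (kernel_ge0 _ _ Hk).
have k_eq0 : wsq k = 0.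
  apply/eqP; apply/negPn/negP => kn0.
  have [t [t0 t1 opt]] := opnorm_real.
  have kfin : wsq k \is a fin_num by rewrite ge0_fin_numE// wsq_ge0.
  have c0 : (0 < fine (wsq k))%R by rewrite fine_gt0// kf andbT lt0e kn0 wsq_ge0.
  have kle : wsq k <= (fine (wsq k))%:E by rewrite fineK.
  have := opnorm_bound t _ k t0 c0 opt mk k0 kle.
  apply/negP; rewrite -ltNge.
  apply: (@lt_le_trans _ _ (wsq k)); last first.
    by apply: le_wsq => //; exact: wkop_meas.
  rewrite -[ltRHS]fineK// lte_fin -[ltRHS]mul1r ltr_pM2r// expr_lt1//.
have : ae_eq mu [set: S] (fun x => (w x)%:E * (k x * k x)) (cst 0).
  apply/ae_eq_integral_abs => //; first exact: wsq_int_meas.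
  by under eq_integral do rewrite gee0_abs ?wsq_int_ge0//.
apply: filterS => x /(_ I) /eqP; rewrite /k -!EFinM eqe !mulf_eq0 gt_eqF//= orbb.
by rewrite normr_eq0 subr_eq0 => /eqP.
Qed.

Lemma wnorm2_ltP (F : S -> \bar R) : (wnorm2 mu w F < +oo) <-> (wsq F < +oo).
Proof.
split; first by apply: lty_poweRy; rewrite invr_eq0.
exact: poweR_lty.
Qed.

Lemma fine_resolvent_wsq : wsq (EFin \o (fine \o resolvent)) < +oo.
Proof.
apply: le_lt_trans resolvent_wsq; apply: le_wsq.
- by apply/measurable_EFinP; apply: measurableT_comp => //; exact: measurable_resolvent.
- exact: measurable_resolvent.
- by move=> x; rewrite lee_fin fine_ge0// resolvent_ge0.
- by apply: filterS resolvent_fin => x /= /fineK ->.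
Qed.

Lemma measurable_fine_resolvent : measurable_fun [set: S] (fine \o resolvent).
Proof. by apply: measurableT_comp => //; exact: measurable_resolvent. Qed.

Lemma fine_resolvent_fixpoint :
  {ae mu, forall x, (fine (resolvent x))%:E = 1 + Top mu kappa w (fine \o resolvent) x}.
Proof.
apply: filterS resolvent_fin => x xfin; rewrite fineK// TopE.
rewrite (wkop_fine resolvent); [exact: resolvent_fixpoint|exact:
    measurable_resolvent|exact: resolvent_ge0|exact: resolvent_fin].
Qed.

(** Common to both cases: [C] stands for [chi] with weight 1, and for [chihat] with weight
    [1 - rho]. *)
Lemma neumann_solution (C : S -> \bar R) : (forall x, C x = (w x)%:E * resolvent x) ->
  (exists g : S -> R, [/\ measurable_fun [set: S] g,
     wnorm2 mu w (fun x => (g x)%:E) < +oo &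
     {ae mu, forall x, (g x)%:E = 1 + Top mu kappa w g x}]) /\
  (forall g : S -> R, measurable_fun [set: S] g ->
     wnorm2 mu w (fun x => (g x)%:E) < +oo ->
     {ae mu, forall x, (g x)%:E = 1 + Top mu kappa w g x} ->
     [/\ {ae mu, forall x, C x = ((w x * g x)%R)%:E},
         \int[mu]_x C x = \int[mu]_x ((g x * 1 * w x)%R)%:E &
         \int[mu]_x C x < +oo]).
Proof.
move=> CE; split.
  exists (fine \o resolvent); split; first exact: measurable_fine_resolvent.
    by apply/wnorm2_ltP; exact: fine_resolvent_wsq.
  exact: fine_resolvent_fixpoint.
move=> g mg /wnorm2_ltP gf Eg.
have gE := fixpoint_unique g _ mg measurable_fine_resolvent gf fine_resolvent_wsq Eg
  fine_resolvent_fixpoint.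
have CgE : {ae mu, forall x, C x = ((w x * g x)%R)%:E}.
  apply: filterS2 gE resolvent_fin => x -> xfin.
  by rewrite CE EFinM /= fineK.
have mC : measurable_fun [set: S] C.
  rewrite (_ : C = fun x => (w x)%:E * resolvent x); last exact/funext.
  by apply: wmul_meas; exact: measurable_resolvent.
split => //.
  apply: ae_eq_integral => //.
    apply/measurable_EFinP; apply: measurable_funM => //; exact: measurable_funM.
  by apply: filterS CgE => x -> _; rewrite mulr1 mulrC.
(* Since [resolvent >= 1], it is dominated by its own square. *)
apply: le_lt_trans resolvent_wsq.
apply: ge0_le_integral => //.
- by move=> x _; rewrite CE wmul_ge0//; exact: resolvent_ge0.
- exact: wsq_int_meas measurable_resolvent.
- move=> x _; rewrite CE lee_wpmul2l ?lee_fin//.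
  by rewrite -[leLHS]mule1 lee_wpmul2l ?resolvent_ge0// resolvent_ge1.
Qed.

End Weighted.

(** * Expected sizes as Neumann series *)

Section Susceptibility.
Context {R : realType} {d : measure_display} {S : measurableType d}.
Variables (mu : probability S R) (kappa : S -> S -> R).
Context {dO : measure_display} {Om : measurableType dO}.
Variables (P : S -> probability Om R) (X : nat -> Om -> ttree S).
Hypothesis Hk : is_kernel mu kappa.
Hypothesis HX : is_branching_process mu kappa P X.
Local Open Scope ereal_scope.
Local Notation K := (kop mu kappa).
Let w x : R := (1 - rho P X x)%R.
Let one : S -> R := fun=> 1%R.

Lemma wkop_one F x : wkop mu kappa one F x = K F x.
Proof. by apply: eq_integral => y _; rewrite mul1e. Qed.

(** Generations 0, ..., n contribute the n + 1 terms T^0 1, ..., T^n 1, hence the shift of index. *)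
Lemma law_size_neumann n x :
  law_size mu kappa true n x = neumann mu kappa one n.+1 x.
Proof.
elim: n x => [|n IH] x.
  rewrite law_size0// /= wkop_one /kop; under eq_integral do rewrite mule0.
  by rewrite integral0 adde0.
rewrite law_sizeS// law_mass_true// mul1e [RHS]/= wkop_one.
by congr (_ + _); apply: eq_integral => y _; rewrite IH.
Qed.

Let neumann_one_nd n x : neumann mu kappa one n x <= neumann mu kappa one n.+1 x.
Proof. by apply: neumann_nd => //; exact: measurable_cst. Qed.

Lemma chi_resolvent x : chi P X x = (one x)%:E * resolvent mu kappa one x.
Proof.
rewrite mul1e (chiE _ _ _ _ HX) (eq_sup_range _ _ (law_size_neumann ^~ x)).
apply: sup_range_cvg => [n|]; first exact: neumann_one_nd.
by rewrite (cvg_shiftS (neumann mu kappa one ^~ x)); exact: cvg_sup_range.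
Qed.

Let w_gt0 x : (0 < w x)%R. Proof. exact: (extinction_gt0 mu kappa). Qed.
Let mw : measurable_fun [set: S] w.
Proof. exact: (measurable_extinction mu kappa). Qed.
Let w_ge0 x : (0 <= w x)%R. Proof. exact: ltW. Qed.
Let size := law_size mu kappa false.
Let size0 n x : 0 <= size n x. Proof. exact: law_size_ge0. Qed.
Let msize n : measurable_fun [set: S] (size n). Proof. exact: measurable_law_size. Qed.
Let size_nd n x : size n x <= size n.+1 x. Proof. exact: law_size_nd. Qed.
Let chihat_cvg x : size n x @[n --> \oo] --> chihat P X x.
Proof. by rewrite (chihatE mu kappa)//; apply: cvg_sup_range. Qed.

Let mass_le n x : law_mass mu kappa false n x <= (w x)%:E.
Proof. by rewrite (extinctionE mu kappa)//; apply: ereal_sup_ubound; exists n. Qed.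

Lemma chihat_ge0 x : 0 <= chihat P X x.
Proof. by rewrite (chihatE mu kappa)//; apply: (le_trans (size0 0 x));
  apply: ereal_sup_ubound; exists 0%N. Qed.

Lemma measurable_chihat : measurable_fun [set: S] (chihat P X).
Proof. by apply: (emeasurable_fun_cvg _ _ msize) => x _; exact: chihat_cvg. Qed.

Lemma chihat_fixpoint x : chihat P X x = (w x)%:E * (1 + K (chihat P X) x).
Proof.
have cK : K (size n) x @[n --> \oo] --> K (chihat P X) x.
  rewrite (_ : chihat P X = fun y => ereal_sup (range (size^~ y))); last first.
    by apply/funext => y; rewrite (chihatE mu kappa).
  rewrite kop_sup//; apply: cvg_sup_range => n.
  by apply: le_kop => //; exact: aeW.
have K0 : 0 <= K (chihat P X) x by apply: kop_ge0 => // y; exact: chihat_ge0.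
have c1 : size n.+1 x @[n --> \oo] --> (w x)%:E * (1 + K (chihat P X) x).
  under eq_fun do rewrite /size law_sizeS//.
  apply: cvgeM.
  (* Both limits are positive, so the product is never of the form 0 times infinity. *)
  - by apply: neq0_mule_def; rewrite gt_eqF// mule_gt0 ?lte_fin// (@lt_le_trans _ _ 1)//
      leeDl.
  - rewrite (cvg_shiftS (law_mass mu kappa false ^~ x)); exact: (extinction_cvg mu kappa).
  - by apply: cvgeD; [rewrite ge0_adde_def ?inE|exact: cvg_cst|exact: cK].
have c2 : size n.+1 x @[n --> \oo] --> chihat P X x.
  by rewrite (cvg_shiftS (size^~ x)); exact: chihat_cvg.
by rewrite -(cvg_lim _ c2)// -(cvg_lim _ c1).
Qed.

(* [chihat / w] solves the resolvent equation, but possibly not minimally: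
   minimality comes from comparing the extinct trees generation by generation. *)
Lemma chihat_resolvent x : chihat P X x = (w x)%:E * resolvent mu kappa w x.
Proof.
have N0 n y : 0 <= neumann mu kappa w n y by exact: neumann_ge0.
have mN n : measurable_fun [set: S] (neumann mu kappa w n) by exact: measurable_neumann.
apply/eqP; rewrite eq_le; apply/andP; split.
  rewrite (chihatE mu kappa)//; apply: ge_ereal_sup => _ [n _ <-].
  apply: (@le_trans _ _ ((w x)%:E * neumann mu kappa w n x)); last first.
    by rewrite lee_wpmul2l ?lee_fin//; apply: ereal_sup_ubound; exists n.
  elim: n x => [|n IH] x; first by rewrite law_size0// mule0.
  rewrite law_sizeS// lee_pmul ?law_mass_ge0//.
    by rewrite adde_ge0// kop_ge0.
  rewrite leeD2l// le_kop//.
  - exact: wmul_meas.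
  - exact: aeW.
  - exact: wmul_ge0.
rewrite -wneumann_sup//; apply: ge_ereal_sup => _ [n _ <-].
elim: n x => [|n IH] x; first by rewrite mule0 chihat_ge0.
rewrite chihat_fixpoint lee_wpmul2l ?lee_fin// leeD2l//; apply: le_kop => //.
- exact: wmul_meas.
- exact: measurable_chihat.
- exact: wmul_ge0.
- exact: aeW.
- by move=> y; exact: chihat_ge0.
Qed.

End Susceptibility.

(** Zeros of [f] are harmless: the inverse and the power [-1] both take the default value 0
    there. *)
Lemma measurable_inv_ge0 {R : realType} d (T : measurableType d) (f : T -> R) :
  measurable_fun [set: T] f -> (forall x, 0 <= f x) ->
  measurable_fun [set: T] (fun x => (f x)^-1).
Proof.
move=> mf f0; rewrite (_ : (fun _ => _) = (@powR R ^~ (-1)) \o f); last first.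
  by apply/funext => x /=; rewrite powR_inv1.
by apply: measurableT_comp => //; exact: measurable_powR.
Qed.

(** * Schur test and quadratic forms *)

Section Bilinear.
Context {R : realType} {d : measure_display} {S : measurableType d}.
Variables (mu : probability S R) (kappa : S -> S -> R).
Hypothesis Hk : is_kernel mu kappa.
Local Open Scope ereal_scope.
Local Notation K := (kop mu kappa).
Local Notation lam := (lam mu kappa).

Lemma kop_lam0 (h : S -> \bar R) x : measurable_fun [set: S] h ->
  (forall y, 0 <= h y) -> lam x = 0%R -> K h x = 0.
Proof.
move=> mh h0 lx.
have : ae_eq mu [set: S] (fun y => (kappa x y)%:E * cst 1 y) (cst 0).
  apply/ae_eq_integral_abs => //; first exact: (kop_integrand_meas _ _ Hk).
  transitivity (K (cst 1) x); last by rewrite lamE// lx.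
  by apply: eq_integral => y _; rewrite gee0_abs// mule_ge0 ?lee_fin ?(kernel_ge0 _ _ Hk).
move=> k0; rewrite /kop (ae_eq_integral (cst 0)) ?integral0//.
  exact: (kop_integrand_meas _ _ Hk).
by apply: filterS k0 => y /(_ I) /=; rewrite mule1 => -> _; rewrite mul0e.
Qed.

Lemma kop_eq0_ae (h : S -> \bar R) x : measurable_fun [set: S] h ->
  (forall y, 0 <= h y) -> K h x = 0 -> {ae mu, forall y, (kappa x y)%:E * h y = 0}.
Proof.
move=> mh h0 Kx.
have : ae_eq mu [set: S] (fun y => (kappa x y)%:E * h y) (cst 0).
  apply/ae_eq_integral_abs => //; first exact: (kop_integrand_meas _ _ Hk).
  by under eq_integral do rewrite gee0_abs ?(kop_integrand_ge0 _ _ Hk)//.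
by apply: filterS => y /(_ I).
Qed.

Lemma ge0_integral_eq0_ae (h : S -> \bar R) : measurable_fun [set: S] h ->
  (forall y, 0 <= h y) -> \int[mu]_x h x = 0 -> {ae mu, forall y, h y = 0}.
Proof.
move=> mh h0 hx; have : ae_eq mu [set: S] h (cst 0).
  apply/ae_eq_integral_abs => //.
  by under eq_integral do rewrite gee0_abs//.
by apply: filterS => y /(_ I).
Qed.

(** Carries the side condition of the Schur test from [phi] to [K phi]. On the zero set B of [phi]
    the intensity vanishes, so by symmetry almost no type sends kernel mass into B; and
    [K phi x = 0] excludes mass outside B. *)
Lemma kop_eq0_lam0 (phi : S -> R) : measurable_fun [set: S] phi ->
  (forall x, (0 <= phi x)%R) ->
  {ae mu, forall x, phi x = 0%R -> lam x = 0%R} ->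
  {ae mu, forall x, K (EFin \o phi) x = 0 -> lam x = 0%R}.
Proof.
move=> mphi phi0 Hphi.
have phi0E y : 0 <= (EFin \o phi) y by rewrite lee_fin.
pose B := [set x | phi x = 0%R].
have mB : measurable B.
  rewrite (_ : B = phi @^-1` [set 0%R]); last by [].
  by rewrite -[X in measurable X]setTI; exact: mphi.
have mBE : measurable_fun [set: S] (EFin \o (\1_B : S -> R)) by exact/measurable_EFinP.
have B0 (y : S) : 0 <= (EFin \o (\1_B : S -> R)) y by rewrite lee_fin.
have KB : {ae mu, forall x, K (EFin \o \1_B) x = 0}.
  apply: ge0_integral_eq0_ae => [|x|].
  - exact: kop_meas.
  - exact: kop_ge0.
  transitivity (\int[mu]_x (cst 1 x * K (EFin \o \1_B) x)).
    by apply: eq_integral => x _; rewrite mul1e.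
  rewrite (kop_symm _ _ Hk)//.
  transitivity (\int[mu]_x (cst 0 x : \bar R)); last by rewrite integral0.
  apply: ae_eq_integral => //.
    apply: emeasurable_funM => //; exact: kop_meas.
  apply: filterS Hphi => x Hx _; rewrite /= lamE//.
  rewrite indicE; case: (boolP (x \in B)) => [/set_mem/Hx ->|_]; first by rewrite mule0.
  by rewrite mul0e.
apply: filterS KB => x KBx Kx.
have {}Kx := kop_eq0_ae _ _ ((measurable_EFinP _ _).2 mphi) phi0E Kx.
have {}KBx := kop_eq0_ae _ _ mBE B0 KBx.
apply: EFin_inj; rewrite -(lamE _ _ Hk) /kop.
transitivity (\int[mu]_x (cst 0 x : \bar R)); last by rewrite integral0.
apply: ae_eq_integral => //; first exact: (kop_integrand_meas _ _ Hk).
apply: filterS2 Kx KBx => y /= a b _; rewrite mule1.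
move: a b; rewrite indicE -!EFinM => -[/eqP]; rewrite mulf_eq0 => /orP[/eqP -> //|/eqP py].
by rewrite mem_set// mulr1 => ->.
Qed.

(* The Schur test: 2 F(y) G(x) <= G(x)^2 phi(y)/phi(x) + F(y)^2 phi(x)/phi(y).
   Division by [phi x = 0] yields [0], which is harmless under [Hphi]. *)
Lemma schur (phi F G : S -> R) : measurable_fun [set: S] phi ->
  (forall x, (0 <= phi x)%R) ->
  {ae mu, forall x, phi x = 0%R -> lam x = 0%R} ->
  measurable_fun [set: S] F -> (forall x, (0 <= F x)%R) ->
  measurable_fun [set: S] G -> (forall x, (0 <= G x)%R) ->
  2%:E * \int[mu]_x ((G x)%:E * K (EFin \o F) x) <=
  \int[mu]_x ((G x ^+ 2 / phi x)%R%:E * K (EFin \o phi) x) +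
  \int[mu]_x ((F x ^+ 2 / phi x)%R%:E * K (EFin \o phi) x).
Proof.
move=> mphi phi0 Hphi mF F0 mG G0.
(* Both functions are cut down to the set where [phi] is nonzero. The integrals do not change,
   because [lam], and with it every [K h], vanishes a.e. on the rest. *)
pose c x : R := (phi x != 0%R)%:R.
have mc : measurable_fun [set: S] c.
  rewrite (_ : c = \1_([set x | phi x != 0%R])); last first.
    apply/funext => x; rewrite indicE /c; congr (_%:R).
    by case: (boolP (phi x != 0%R)) => h; [rewrite mem_set|rewrite memNset//; exact/negP].
  apply: measurable_indic.
  rewrite (_ : [set x | _] = ~` (phi @^-1` [set 0%R])); last first.
    by apply/seteqP; split=> x /=; [move=> /eqP|move=> /eqP].
  by apply: measurableC; rewrite -[X in measurable X]setTI; exact: mphi.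
have c0 x : (0 <= c x)%R by [].
have trim (f g : S -> R) : measurable_fun [set: S] f -> (forall x, (0 <= f x)%R) ->
  measurable_fun [set: S] g -> (forall x, (0 <= g x)%R) ->
  \int[mu]_x ((f x)%:E * K (EFin \o g) x) =
  \int[mu]_x ((f x * c x)%:E * K (EFin \o g) x).
  move=> mf f0 mg g0; have mgE : measurable_fun [set: S] (EFin \o g) by
      exact/measurable_EFinP.
  have g0E y : 0 <= (EFin \o g) y by rewrite lee_fin.
  apply: ae_eq_integral => //.
  - apply: emeasurable_funM; [exact/measurable_EFinP|exact: kop_meas].
  - apply: emeasurable_funM; last exact: kop_meas.
    by apply/measurable_EFinP; exact: measurable_funM.
  apply: filterS Hphi => x Hx _; rewrite /c; case: eqP => [/Hx lx|_]; last by rewrite mulr1.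
  by rewrite (kop_lam0 (EFin \o g))// !mule0.
pose F' x := (F x * c x)%R; pose G' x := (G x * c x)%R.
have mF' : measurable_fun [set: S] F' by exact: measurable_funM.
have mG' : measurable_fun [set: S] G' by exact: measurable_funM.
have F'0 x : (0 <= F' x)%R by exact: mulr_ge0.
have G'0 x : (0 <= G' x)%R by exact: mulr_ge0.
have -> : \int[mu]_x ((G x)%:E * K (EFin \o F) x) = \int[mu]_x ((G' x)%:E * K (EFin \o
    F') x).
  have E (h : S -> R) : measurable_fun [set: S] h -> measurable_fun [set: S] (EFin \o h)
      by move=> /measurable_EFinP.
  rewrite trim// -/(G' _) (kop_symm _ _ Hk (EFin \o G') (EFin \o F)); try exact: E;
    try by move=> x; rewrite lee_fin.
  rewrite trim// -/(F' _) (kop_symm _ _ Hk (EFin \o F') (EFin \o G')) //; try exact: E;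
    try by move=> x; rewrite lee_fin.
pose qF x := (F x ^+ 2 / phi x)%R.
have mq (f : S -> R) : measurable_fun [set: S] f ->
    measurable_fun [set: S] (EFin \o (fun x => f x ^+ 2 / phi x)%R).
  move=> mf; apply/measurable_EFinP; apply: measurable_funM; first exact: measurable_funX.
  exact: measurable_inv_ge0.
have q0 (f : S -> R) x : 0 <= (f x ^+ 2 / phi x)%R%:E by rewrite lee_fin divr_ge0// sqr_ge0.
have mphiE : measurable_fun [set: S] (EFin \o phi) by exact/measurable_EFinP.
have phi0E x : 0 <= (EFin \o phi) x by rewrite lee_fin.
have mF'E : measurable_fun [set: S] (EFin \o F') by exact/measurable_EFinP.
have F'0E x : 0 <= (EFin \o F') x by rewrite lee_fin.
have mG'E : measurable_fun [set: S] (EFin \o G') by exact/measurable_EFinP.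
(* With [phi] moved outside [K], all three terms are double integrals of [kappa x y] in the same
   order, and can be compared pointwise. *)
rewrite -[X in _ <= _ + X](kop_symm _ _ Hk (EFin \o phi) (EFin \o qF))//;
  [|exact: (mq F mF)|exact: (q0 F)].
rewrite -ge0_integralD//; last 4 first.
- by move=> x _; rewrite mule_ge0// kop_ge0.
- by apply: emeasurable_funM; [exact: mq|exact: kop_meas].
- by move=> x _; rewrite mule_ge0// kop_ge0// => y; exact: q0.
- by apply: emeasurable_funM => //; apply: kop_meas => //; [exact: mq|exact: q0].
rewrite -ge0_integralZl//; last 2 first.
- by apply: emeasurable_funM => //; exact: kop_meas.
- by move=> x _; rewrite mule_ge0 ?lee_fin// kop_ge0.
apply: ge0_le_integral => //.
- by move=> x _; rewrite !mule_ge0 ?lee_fin// kop_ge0.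
- by apply: measurable_funeM; apply: emeasurable_funM => //; exact: kop_meas.
- apply: emeasurable_funD.
    by apply: emeasurable_funM; [exact: mq|exact: kop_meas].
  by apply: emeasurable_funM => //; apply: kop_meas => //; [exact: mq|exact: q0].
move=> x _; rewrite muleA -[in leLHS]kopZ//; last by rewrite mule_ge0 ?lee_fin.
rewrite -[X in _ <= X + _]kopZ// -[X in _ <= _ + X]kopZ//; [|exact: mq|exact: q0].
rewrite /kop -ge0_integralD//; last 4 first.
- by move=> y _; rewrite mule_ge0 ?(mule_ge0 (q0 _ _))// lee_fin (kernel_ge0 _ _ Hk).
- by apply: (kop_integrand_meas _ _ Hk) => //; exact: measurable_funeM.
- by move=> y _; rewrite mule_ge0 ?(mule_ge0 (phi0E _) (q0 _ _))// lee_fin (kernel_ge0 _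
    _ Hk).
- by apply: (kop_integrand_meas _ _ Hk) => //; apply: measurable_funeM; exact: mq.
apply: ge0_le_integral => //.
- move=> y _; rewrite mule_ge0//; first by rewrite lee_fin (kernel_ge0 _ _ Hk).
  by rewrite mule_ge0// mule_ge0// lee_fin.
- by apply: (kop_integrand_meas _ _ Hk) => //; exact: measurable_funeM.
- by apply: emeasurable_funD; apply: (kop_integrand_meas _ _ Hk) => //;
  apply: measurable_funeM => //; exact: mq.
move=> y _; rewrite /= -!EFinM -EFinD lee_fin -mulrDr ler_wpM2l ?(kernel_ge0 _ _ Hk)//.
rewrite /F' /G' /qF /c; case: eqP => [px|/eqP px];
  first by rewrite mulr0 mulr0 mul0r px invr0 !mulr0 !mul0r addr0.
case: eqP => [py|/eqP py]; first by rewrite py invr0 !mulr0 addr0.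
rewrite !mulr1.
have px0 : (0 < phi x)%R by rewrite lt_def px phi0.
have py0 : (0 < phi y)%R by rewrite lt_def py phi0.
rewrite -subr_ge0.
have -> : (G x ^+ 2 / phi x * phi y + phi x * (F y ^+ 2 / phi y) - 2 * G x * F y =
  (G x * phi y - F y * phi x) ^+ 2 / (phi x * phi y))%R.
  by field; rewrite px py.
by rewrite divr_ge0 ?sqr_ge0// mulr_ge0// ltW.
Qed.

Section FormBound.
Variable w : S -> R.
Hypothesis mw : measurable_fun [set: S] w.
Hypothesis w_gt0 : forall x, (0 < w x)%R.
Hypothesis w_le1 : forall x, (w x <= 1)%R.

Let w_ge0 x : (0 <= w x)%R. Proof. exact: ltW. Qed.

(** The image of a function may have infinite norm; its truncations are bounded, so they can be
    normalised. *)
Lemma wsq_min_approx (H : S -> \bar R) : measurable_fun [set: S] H ->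
  (forall x, 0 <= H x) ->
  wsq mu w H = ereal_sup (range (fun j : nat => wsq mu w (fun x => mine (H x) j%:R%:E))).
Proof.
move=> mH H0.
have m0 (j : nat) x : 0 <= mine (H x) j%:R%:E by rewrite le_min H0 lee_fin ler0n.
have mm (j : nat) : measurable_fun [set: S] (fun x => mine (H x) j%:R%:E) by exact:
    measurable_mine.
have nd (j : nat) x : mine (H x) j%:R%:E <= mine (H x) j.+1%:R%:E.
  by rewrite le_min ge_min lexx /= ge_min lee_fin ler_nat leqnSn orbT.
have cv x : mine (H x) j%:R%:E @[j --> \oo] --> H x.
  have E : ereal_sup (range (fun j : nat => mine (H x) j%:R%:E)) = H x.
    apply/eqP; rewrite eq_le; apply/andP; split.
      by apply: ge_ereal_sup => _ [j _ <-]; rewrite ge_min lexx.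
    have := H0 x; case: (H x) => [h h0| _|//].
      apply: ereal_sup_ubound; exists (Num.truncn h).+1 => //.
      by apply/min_idPl; rewrite lee_fin ltW// truncnS_gt.
    rewrite leye_eq; apply/eqP/eq_infty => t.
    apply: (@le_trans _ _ ((Num.truncn t).+1%:R%:E));
      first by rewrite lee_fin ltW// truncnS_gt.
    by apply: ereal_sup_ubound; exists (Num.truncn t).+1 => //; apply/min_idPr; exact: leey.
  by rewrite -[X in _ --> X]E; exact: cvg_sup_range.
rewrite -(integral_ereal_sup _ _ mu (fun (j : nat) x => (w x)%:E * (mine (H x) j%:R%:E *
    mine (H x) j%:R%:E))).
- apply: eq_integral => x _; apply/esym/sup_range_cvg => [j|].
    by rewrite lee_wpmul2l ?lee_fin// lee_pmul.
  apply: cvgeZl => //; have [Hx0|Hx0] := eqVneq (H x) 0.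
    rewrite Hx0 mule0; under eq_fun do rewrite (min_idPl _) ?lee_fin// mule0.
    exact: cvg_cst.
  by apply: cvgeM => //; apply: neq0_mule_def; rewrite mule_eq0 negb_or Hx0.
- by move=> j; exact: wsq_int_meas.
- by move=> j x; exact: (wsq_int_ge0 _ w_gt0 (fun x => mine (H x) j%:R%:E)).
- by move=> j x; rewrite lee_wpmul2l ?lee_fin// lee_pmul.
Qed.

(** Duality: the form is tested against T f itself, truncated at j and divided by its norm. *)
Lemma opnorm_le_form (c : R) : (0 <= c)%R ->
  (forall f g : S -> R, measurable_fun [set: S] f -> (forall x, (0 <= f x)%R) ->
     measurable_fun [set: S] g -> (forall x, (0 <= g x)%R) ->
     wsq mu w (EFin \o f) <= 1 -> wsq mu w (EFin \o g) <= 1 ->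
     \int[mu]_x ((w x * g x)%:E * wkop mu kappa w (EFin \o f) x) <= c%:E) ->
  opnorm mu kappa w <= c%:E.
Proof.
move=> c0 form; apply: ge_ereal_sup => _ [f [mf f0 f1] <-].
rewrite poweR_half_le//; last exact: wsq_ge0.
have mfE : measurable_fun [set: S] (EFin \o f) by exact/measurable_EFinP.
have f0E x : 0 <= (EFin \o f) x by rewrite lee_fin.
have {}f1 : wsq mu w (EFin \o f) <= 1.
  by move: f1; rewrite poweR_half_le ?expr1n//; exact: wsq_ge0.
rewrite TopE -/(wsq mu w _).
set H := wkop mu kappa w (EFin \o f).
have mH : measurable_fun [set: S] H by exact: wkop_meas.
have H0 x : 0 <= H x by exact: wkop_ge0.
rewrite wsq_min_approx//; apply: ge_ereal_sup => _ [j _ <-].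
pose h x := fine (mine (H x) j%:R%:E).
have hE x : (h x)%:E = mine (H x) j%:R%:E.
  rewrite fineK// ge0_fin_numE; last by rewrite le_min H0 lee_fin ler0n.
  by rewrite gt_min ltry orbT.
have h0 x : (0 <= h x)%R by rewrite -lee_fin hE le_min H0 lee_fin ler0n.
have hj x : (h x <= j%:R)%R by rewrite -lee_fin hE ge_min lexx orbT.
have mh : measurable_fun [set: S] h by apply: measurableT_comp => //;
  exact: measurable_mine.
have mhE : measurable_fun [set: S] (EFin \o h) by exact/measurable_EFinP.
rewrite (_ : (fun x => mine (H x) j%:R%:E) = EFin \o h); last by apply/funext => x /=;
  rewrite hE.
have Nfin : wsq mu w (EFin \o h) < +oo.
  apply: (@le_lt_trans _ _ (\int[mu]_x (cst ((j%:R * j%:R)%R%:E) x))); last first.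
    by rewrite integral_cst//= probability_setT mule1 ltry.
  apply: ge0_le_integral => //.
  - by move=> x _; exact: wsq_int_ge0.
  - refine (wsq_int_meas w mw (EFin \o h) mhE).
  - by move=> x _; rewrite lee_fin -[leRHS]mul1r ler_pM ?mulr_ge0// ler_pM.
have Nf : wsq mu w (EFin \o h) \is a fin_num by rewrite ge0_fin_numE// wsq_ge0.
set N := fine (wsq mu w (EFin \o h)).
have NE : wsq mu w (EFin \o h) = N%:E by rewrite fineK.
rewrite NE lee_fin.
have N0 : (0 <= N)%R by rewrite fine_ge0// wsq_ge0.
have [->|Nn0] := eqVneq N 0%R; first exact: sqr_ge0.
have Np : (0 < N)%R by rewrite lt_def Nn0.
have sN : (0 < Num.sqrt N)%R by rewrite sqrtr_gt0.
(* As h <= T f, the form at g is at least N divided by the root of N, so this root is at most c. *)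
pose g x := ((Num.sqrt N)^-1 * h x)%R.
have g0 x : (0 <= g x)%R by rewrite mulr_ge0// invr_ge0 ltW.
have mg : measurable_fun [set: S] g by exact: measurable_funM.
have g1 : wsq mu w (EFin \o g) <= 1.
  rewrite (_ : EFin \o g = fun x => (Num.sqrt N)^-1%:E * (EFin \o h) x); last first.
    by apply/funext => x; rewrite /= -EFinM.
  by rewrite wsqZ// NE exprVn sqr_sqrtr// -EFinM mulVf.
have := form f g mf f0 mg g0 f1 g1.
have le : (Num.sqrt N)^-1%:E * N%:E <= \int[mu]_x ((w x * g x)%:E * H x).
  rewrite -NE -ge0_integralZl//; last 2 first.
  - exact: (wsq_int_meas _ mw (EFin \o h)).
  - by move=> x _; exact: wsq_int_ge0.
  apply: ge0_le_integral => //.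
  - move=> x _; apply: mule_ge0; first by rewrite lee_fin invr_ge0 ltW.
    exact: (wsq_int_ge0 _ w_gt0 (EFin \o h)).
  - by apply: measurable_funeM; exact: (wsq_int_meas _ mw (EFin \o h)).
  - apply: emeasurable_funM => //; apply/measurable_EFinP; exact: measurable_funM.
  - move=> x _.
    have -> : (Num.sqrt N)^-1%:E * ((w x)%:E * ((EFin \o h) x * (EFin \o h) x)) =
        (w x * g x)%:E * (h x)%:E.
      by rewrite /= -!EFinM; congr EFin; rewrite /g; ring.
    by rewrite lee_wpmul2l ?lee_fin ?mulr_ge0// hE ge_min lexx.
move=> /(le_trans le); rewrite -EFinM lee_fin => sNc.
have {}sNc : (Num.sqrt N <= c)%R.
  by move: sNc; rewrite -{2}(sqr_sqrtr N0) expr2 mulrA mulVf ?mul1r// gt_eqF.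
by rewrite -(sqr_sqrtr N0) ler_sqr// nnegrE sqrtr_ge0.
Qed.

End FormBound.
End Bilinear.

(** If one supremum is 0, its sequence is constantly 0, which settles the product 0 times infinity;
    otherwise the product of limits is defined. *)
Lemma sup_rangeM {R : realType} (u v : nat -> \bar R) :
  (forall n, 0 <= u n)%E -> (forall n, 0 <= v n)%E ->
  (forall n, u n <= u n.+1)%E -> (forall n, v n <= v n.+1)%E ->
  (ereal_sup (range u) * ereal_sup (range v) =
   ereal_sup (range (fun n => u n * v n)))%E.
Proof.
move=> u0 v0 ndu ndv; apply/esym.
have z (f : nat -> \bar R) : (forall n, 0 <= f n)%E -> ereal_sup (range f) = 0%E ->
    forall n, f n = 0%E.
  move=> f0 f_sup n; apply/eqP; rewrite eq_le f0 andbT -f_sup.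
  by apply: ereal_sup_ubound; exists n.
have c0 : ereal_sup (range (fun _ : nat => 0%E : \bar R)) = 0%E :> \bar R.
  by apply: (sup_range_cvg (fun=> 0%E) 0%E) => //; exact: cvg_cst.
have [su|su] := eqVneq (ereal_sup (range u)) 0%E.
  by rewrite su mul0e -[RHS]c0; apply: eq_sup_range => n; rewrite (z u)// mul0e.
have [sv|sv] := eqVneq (ereal_sup (range v)) 0%E.
  by rewrite sv mule0 -[RHS]c0; apply: eq_sup_range => n; rewrite (z v)// mule0.
apply: sup_range_cvg => [n|]; first exact: lee_pmul.
apply: cvgeM; [|exact: cvg_sup_range|exact: cvg_sup_range].
by apply: neq0_mule_def; rewrite mule_eq0 negb_or su.
Qed.

Lemma ge0_dominated_cvg {R : realType} d (T : measurableType d)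
    (mu : {measure set T -> \bar R}) (u : nat -> T -> R) (v g : T -> R) :
  (forall n, measurable_fun [set: T] (u n)) -> measurable_fun [set: T] v ->
  measurable_fun [set: T] g -> (forall n x, 0 <= u n x <= g x) ->
  (forall x, u n x @[n --> \oo] --> v x) ->
  (\int[mu]_x (g x)%:E < +oo)%E ->
  (\int[mu]_x (u n x)%:E)%E @[n --> \oo] --> (\int[mu]_x (v x)%:E)%E.
Proof.
move=> mu_ mv mg ug uv goo.
have g0 x : 0 <= g x by have /andP[] := ug 0%N x; exact: le_trans.
have mE (f : T -> R) : measurable_fun [set: T] f -> measurable_fun [set: T] (EFin \o f).
  by move=> /measurable_EFinP.
have cv : {ae mu, forall x, [set: T] x -> (EFin \o u n) x @[n --> \oo] --> (EFin \o v) x}.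
  by apply: aeW => x _; apply: cvg_EFin (uv x); exact: nearW.
have ig : mu.-integrable [set: T] (EFin \o g).
  apply/integrableP; split; first exact: mE.
  by under eq_integral do rewrite gee0_abs ?lee_fin//.
have dom : {ae mu, forall x n, [set: T] x -> (`|(EFin \o u n) x| <= (EFin \o g) x)%E}.
  by apply: aeW => x n _; have /andP[u0 ?] := ug n x; rewrite gee0_abs ?lee_fin.
by have [_ _] := dominated_convergence measurableT (fun n => mE _ (mu_ n)) (mE _ mv) cv
    ig dom.
Qed.

(** * Supercritical duality *)

Section Duality.
Context {R : realType} {d : measure_display} {S : measurableType d}.
Variables (mu : probability S R) (kappa : S -> S -> R).
Context {dO : measure_display} {Om : measurableType dO}.
Variables (P : S -> probability Om R) (X : nat -> Om -> ttree S).
Hypothesis Hk : is_kernel mu kappa.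
Hypothesis HX : is_branching_process mu kappa P X.
Local Open Scope ereal_scope.
Local Notation K := (kop mu kappa).
Local Notation lam := (lam mu kappa).
Local Notation rho := (rho P X).
Local Notation surv := (survival mu kappa).
Let w x : R := (1 - rho x)%R.
Let one : S -> R := fun=> 1%R.

Let w_gt0 x : (0 < w x)%R. Proof. exact: (extinction_gt0 mu kappa). Qed.
Let w_ge0 x : (0 <= w x)%R. Proof. exact: ltW. Qed.
Let w_le1 x : (w x <= 1)%R. Proof. exact: (extinction_le1 mu kappa). Qed.
Let mw : measurable_fun [set: S] w.
Proof. exact: (measurable_extinction mu kappa). Qed.
Let rho0 x : (0 <= rho x)%R. Proof. exact: (rho_ge0 mu kappa). Qed.
Let rho1 x : (rho x <= 1)%R. Proof. exact: (rho_le1 mu kappa). Qed.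
Let mrho : measurable_fun [set: S] rho. Proof. exact: (measurable_rho mu kappa). Qed.
Let mrhoE : measurable_fun [set: S] (EFin \o rho). Proof. exact/measurable_EFinP. Qed.

Let Kfin (h : S -> R) x : measurable_fun [set: S] h -> (forall y, (0 <= h y <= 1)%R) ->
  K (EFin \o h) x = (fine (K (EFin \o h) x))%:E.
Proof.
move=> mh h01; rewrite fineK//; apply: kop_fin_num => //; first exact/measurable_EFinP.
Qed.

Let t x : R := fine (K (EFin \o rho) x).
Let tE x : K (EFin \o rho) x = (t x)%:E.
Proof. by apply: Kfin => // y; rewrite rho0 rho1. Qed.

Let t_ge0 x : (0 <= t x)%R.
Proof. by rewrite fine_ge0// kop_ge0// => y; rewrite lee_fin. Qed.

Let wt x : w x = expR (- t x).
Proof. exact: (extinction_rho mu kappa). Qed.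

Let rhoE x : rho x = (1 - expR (- t x))%R.
Proof. by rewrite -wt /w subKr. Qed.

Lemma rho_eq0 x : rho x = 0%R <-> t x = 0%R.
Proof.
rewrite rhoE; split=> [/eqP|->]; last by rewrite oppr0 expR0 subrr.
by rewrite subr_eq0 eq_sym -expR0 => /eqP/expR_inj/eqP; rewrite oppr_eq0 => /eqP.
Qed.

Let msurv n : measurable_fun [set: S] (surv n). Proof. exact: measurable_survival. Qed.
Let surv0 n x : (0 <= surv n x)%R. Proof. exact: survival_ge0. Qed.
Let surv1 n x : (surv n x <= 1)%R. Proof. exact: survival_le1. Qed.

Let s n x : R := fine (K (EFin \o surv n) x).
Let sE n x : K (EFin \o surv n) x = (s n x)%:E.
Proof. by apply: Kfin => // y; rewrite surv0 surv1. Qed.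

Let s_ge0 n x : (0 <= s n x)%R.
Proof. by rewrite fine_ge0// kop_ge0// => y; rewrite lee_fin. Qed.

Let s_le_lam n x : (s n x <= lam x)%R.
Proof.
rewrite -lee_fin -sE; apply: kop_le_lam => //; first exact/measurable_EFinP.
by move=> y; rewrite !lee_fin surv0 surv1.
Qed.

Let ms n : measurable_fun [set: S] (s n).
Proof.
apply: measurableT_comp => //; apply: kop_meas => //; first exact/measurable_EFinP.
by move=> y; rewrite lee_fin.
Qed.

Let survS n x : surv n.+1 x = (1 - expR (- s n x))%R.
Proof. exact: survivalS. Qed.

(** The side condition for [schur] with test function [surv n]: it starts from the constant 1, and
    [surv n.+1] vanishes only where [K (surv n)] does. *)
Lemma survival_lam0 n : {ae mu, forall x, surv n x = 0%R -> lam x = 0%R}.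
Proof.
elim: n => [|n IH].
  by apply: aeW => x; rewrite survival0// => /eqP; rewrite oner_eq0.
have := kop_eq0_lam0 _ _ Hk (surv n) (msurv n) (surv0 n) IH.
apply: filterS => x H; rewrite survS => /eqP.
rewrite subr_eq0 eq_sym -expR0 => /eqP/expR_inj/eqP; rewrite oppr_eq0 => /eqP s0.
by apply: H; rewrite sE s0.
Qed.

(* 1 - exp(-s) >= s exp(-s) bounds the Schur multiplier of [surv n]. *)
Let schur_mult n x : (s n x / surv n x <= expR (s n x))%R.
Proof.
have [->|sn0] := eqVneq (surv n x) 0%R; first by rewrite invr0 mulr0 expR_ge0.
have sp : (0 < surv n x)%R by rewrite lt_def sn0 surv0.
rewrite ler_pdivrMr// (@le_trans _ _ (expR (s n x) * surv n.+1 x)%R)//; last first.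
  by rewrite ler_wpM2l ?expR_ge0// survival_ni.
rewrite survS mulrBr mulr1 -expRD subrr expR0.
by have := expR_ge1Dx (s n x); lra.
Qed.

(** * Almost sure extinction forces norm at most one *)

Section NoSurvival.
Hypothesis ext : {ae mu, forall x, rho x = 0%R}.

Let s_cvg0 x : s n x @[n --> \oo] --> 0%R.
Proof.
have mk : measurable_fun [set: S] (kappa x) by exact: (measurable_kernel_snd _ _ Hk).
have c : K (EFin \o surv n) x @[n --> \oo] --> K (EFin \o rho) x.
  apply: (ge0_dominated_cvg _ _ mu (fun n y => kappa x y * surv n y)%R
    (fun y => kappa x y * rho y)%R (kappa x)).
  - by move=> n; exact: measurable_funM.
  - exact: measurable_funM.
  - by [].
  - move=> n y; rewrite mulr_ge0 ?(kernel_ge0 _ _ Hk)//=.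
    by rewrite -[leRHS]mulr1 ler_wpM2l ?(kernel_ge0 _ _ Hk).
  - by move=> y; apply: cvgM; [exact: cvg_cst|exact: (survival_cvg mu kappa P X Hk HX)].
  - by have [_ _ _ _ H] := Hk; exact: H.
have K0 : K (EFin \o rho) x = 0.
  rewrite /kop (ae_eq_integral (cst 0)) ?integral0//.
    exact: (kop_integrand_meas _ _ Hk).
  by apply: filterS ext => y /= -> _; rewrite mule0.
by apply: fine_cvg; move: c; rewrite K0.
Qed.

(* Truncating to [lam <= k] dominates the Schur multiplier, as [s n <= lam]. *)
Let cut (k : nat) x : R := ((lam x <= k%:R)%R)%:R.

Let mcut k : measurable_fun [set: S] (cut k).
Proof.
rewrite (_ : cut k = \1_([set x | (lam x <= k%:R)%R])); last first.
  apply/funext => x; rewrite indicE /cut; congr (_%:R).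
  by case: (boolP (lam x <= _)%R) => h; [rewrite mem_set|rewrite memNset//; exact/negP].
apply: measurable_indic; rewrite -[X in measurable X]setTI.
rewrite (_ : [set x | _] = lam @^-1` `]-oo, k%:R]%classic); last first.
  by apply/seteqP; split=> x /=; rewrite in_itv.
by apply: (measurable_lam _ _ Hk) => //.
Qed.

Let wsq_one (f : S -> R) : wsq mu one (EFin \o f) <= 1 ->
  \int[mu]_x (f x ^+ 2)%R%:E <= 1.
Proof.
by apply: le_trans; under [leRHS]eq_integral do rewrite mul1e.
Qed.

Let sq_cvg (f : S -> R) k : measurable_fun [set: S] f ->
  wsq mu one (EFin \o f) <= 1 ->
  \int[mu]_x ((f x * cut k x) ^+ 2 * expR (s n x))%R%:E @[n --> \oo] -->
  \int[mu]_x ((f x * cut k x) ^+ 2)%R%:E.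
Proof.
move=> mf f1.
have mfk : measurable_fun [set: S] (fun x => (f x * cut k x) ^+ 2)%R.
  by apply: measurable_funX; exact: measurable_funM.
have mf2 : measurable_fun [set: S] (fun x => f x ^+ 2)%R by exact: measurable_funX.
apply: (ge0_dominated_cvg _ _ mu (fun n x => (f x * cut k x) ^+ 2 * expR (s n x))%R
  (fun x => (f x * cut k x) ^+ 2)%R (fun x => expR k%:R * f x ^+ 2)%R) => //.
- by move=> n; apply: measurable_funM => //; exact: measurableT_comp.
- exact: measurable_funM.
- move=> n x; rewrite mulr_ge0 ?sqr_ge0 ?expR_ge0//= /cut.
  case: (boolP (lam x <= k%:R)%R) => lk; last first.
    by rewrite mulr0 expr0n mul0r mulr_ge0 ?expR_ge0 ?sqr_ge0.
  rewrite mulr1 mulrC ler_wpM2r ?sqr_ge0// ler_expR.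
  exact: le_trans (s_le_lam n x) lk.
- move=> x; rewrite -[X in _ --> X]mulr1 -expR0; apply: cvgM; first exact: cvg_cst.
  exact: (cvg_comp _ _ (s_cvg0 x) (@continuous_expR R _)).
under eq_integral do rewrite EFinM.
rewrite ge0_integralZl//.
- apply: lte_mul_pinfty; rewrite ?lee_fin ?expR_ge0//.
  by rewrite (le_lt_trans (wsq_one f f1))// ltry.
- exact/measurable_EFinP.
- by move=> x _; rewrite lee_fin sqr_ge0.
Qed.

(** Two limits in a fixed order: at cut level [k] the index [n] grows, the multipliers [expR (s n)]
    tending to 1 under the bound [expR k]; then [k] grows and monotone convergence restores f and
    g. *)
Lemma extinct_opnorm_le1 : opnorm mu kappa one <= 1.
Proof.
have m1 : measurable_fun [set: S] one by exact: measurable_cst.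
apply: (opnorm_le_form _ _ Hk one m1) => // f g mf f0 mg g0 f1 g1.
have mE (h : S -> R) : measurable_fun [set: S] h -> measurable_fun [set: S] (EFin \o h).
  by move=> /measurable_EFinP.
pose fk k x := (f x * cut k x)%R; pose gk k x := (g x * cut k x)%R.
have mfk k : measurable_fun [set: S] (fk k) by exact: measurable_funM.
have mgk k : measurable_fun [set: S] (gk k) by exact: measurable_funM.
have cut0 k x : (0 <= cut k x)%R by exact: ler0n.
have fk0 k x : (0 <= fk k x)%R by exact: mulr_ge0.
have gk0 k x : (0 <= gk k x)%R by exact: mulr_ge0.
have cutS k x : (cut k x <= cut k.+1 x)%R.
  rewrite ler_nat; case: (boolP (lam x <= k%:R)%R) => // h.
  by rewrite (le_trans h)// ler_nat.
have cut1 k x : (cut k x <= 1)%R by rewrite lern1 leq_b1.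
have hkS (h : S -> R) k x : (0 <= h x)%R -> (h x * cut k x <= h x * cut k.+1 x)%R.
  by move=> hx; rewrite ler_wpM2l.
have hk_sup (h : S -> R) x : (0 <= h x)%R ->
    (h x)%:E = ereal_sup (range (fun k => (h x * cut k x)%:E)).
  move=> hx; apply/eqP; rewrite eq_le; apply/andP; split.
    apply: ereal_sup_ubound; exists (Num.truncn (lam x)).+1 => //.
    by rewrite /cut ltW ?truncnS_gt// mulr1.
  apply: ge_ereal_sup => _ [k _ <-].
  by rewrite lee_fin -[leRHS]mulr1 ler_wpM2l.
have bound k : \int[mu]_x ((gk k x)%:E * K (EFin \o fk k) x) <= 1.
  have sq (h : S -> R) : measurable_fun [set: S] h -> wsq mu one (EFin \o h) <= 1 ->
      \int[mu]_x ((h x * cut k x) ^+ 2)%R%:E <= 1.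
    move=> mh h1; apply: le_trans (wsq_one h h1); apply: ge0_le_integral => //.
    - by move=> x _; rewrite lee_fin sqr_ge0.
    - by apply/measurable_EFinP; apply: measurable_funX; exact: measurable_funM.
    - by apply/measurable_EFinP; exact: measurable_funX.
    - move=> x _; rewrite lee_fin exprMn -[leRHS]mulr1 ler_wpM2l ?sqr_ge0//.
      by rewrite expr_le1.
  have B2 : 2%:E * \int[mu]_x ((gk k x)%:E * K (EFin \o fk k) x) <= 2%:E.
    have cG := sq_cvg g k mg g1; have cF := sq_cvg f k mf f1.
    have lim2 : \int[mu]_x (gk k x ^+ 2)%R%:E + \int[mu]_x (fk k x ^+ 2)%R%:E <= 2%:E.
      by rewrite -[2%R]/(1 + 1)%R EFinD; apply: leeD; exact: sq.
    apply: le_trans lim2.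
    have cGF : (\int[mu]_x ((gk k x) ^+ 2 * expR (s n x))%R%:E +
        \int[mu]_x ((fk k x) ^+ 2 * expR (s n x))%R%:E) @[n --> \oo] -->
        \int[mu]_x (gk k x ^+ 2)%R%:E + \int[mu]_x (fk k x ^+ 2)%R%:E.
      apply: cvgeD; [|exact: cG|exact: cF].
      by apply: ge0_adde_def; rewrite inE; apply: integral_ge0 => x _;
        rewrite lee_fin sqr_ge0.
    (* The form does not involve [n], so it lies below the limit of the Schur bounds. *)
    apply: cvge_ge cGF; apply: nearW => n.
    apply: le_trans (schur _ _ Hk (surv n) (fk k) (gk k) (msurv n) (surv0 n)
      (survival_lam0 n) (mfk k) (fk0 k) (mgk k) (gk0 k)) _.
    have mult (h : S -> R) : measurable_fun [set: S] h ->
        \int[mu]_x ((h x ^+ 2 / surv n x)%R%:E * K (EFin \o surv n) x) <=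
        \int[mu]_x (h x ^+ 2 * expR (s n x))%R%:E.
      move=> mh; have mh2 : measurable_fun [set: S] (fun x => h x ^+ 2)%R by exact:
          measurable_funX.
      under eq_integral do rewrite sE -EFinM -mulrA (mulrC (_^-1)%R).
      apply: ge0_le_integral => //.
      - by move=> x _; rewrite lee_fin mulr_ge0 ?sqr_ge0// divr_ge0.
      - apply/measurable_EFinP; apply: measurable_funM => //; apply: measurable_funM => //.
        exact: measurable_inv_ge0.
      - by apply/measurable_EFinP; apply: measurable_funM => //; exact: measurableT_comp.
      - by move=> x _; rewrite lee_fin ler_wpM2l ?sqr_ge0.
    by apply: leeD; exact: mult.
  by move: B2; rewrite -[leRHS]mule1 lee_pmul2l ?lte_fin.
have -> : \int[mu]_x ((one x * g x)%:E * wkop mu kappa one (EFin \o f) x) =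
    \int[mu]_x ereal_sup (range (fun k => (gk k x)%:E * K (EFin \o fk k) x)).
  apply: eq_integral => x _; rewrite wkop_one mul1r hk_sup//.
  have -> : K (EFin \o f) x = ereal_sup (range (fun k => K (EFin \o fk k) x)).
    rewrite -(kop_sup _ _ Hk (fun k => EFin \o fk k)).
    + by apply: eq_integral => y _; congr (_ * _); exact: hk_sup.
    + by move=> k; exact: mE.
    + by move=> k y; rewrite lee_fin.
    + by move=> k y; rewrite lee_fin hkS.
  rewrite sup_rangeM//.
  - by move=> k; rewrite lee_fin; exact: gk0.
  - by move=> k; apply: kop_ge0 => // y; rewrite lee_fin.
  - by move=> k; rewrite lee_fin hkS.
  - move=> k; apply: le_kop => //; try exact: mE; try by move=> y; rewrite lee_fin.
    by apply: aeW => y; rewrite lee_fin hkS.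
rewrite integral_ereal_sup.
- by apply: ge_ereal_sup => _ [k _ <-]; exact: bound.
- move=> k; apply: emeasurable_funM; first exact: mE.
  by apply: kop_meas => //; [exact: mE|move=> y; rewrite lee_fin].
- by move=> k x; rewrite mule_ge0 ?lee_fin// kop_ge0// => y; rewrite lee_fin.
- move=> k x; rewrite lee_pmul ?lee_fin ?hkS//.
  + by apply: kop_ge0 => // y; rewrite lee_fin.
  + apply: le_kop => //; try exact: mE; try by move=> y; rewrite lee_fin.
    by apply: aeW => y; rewrite lee_fin hkS.
Qed.

End NoSurvival.

(** * Strict contraction of the dual operator *)

Section Irreducible.
Hypothesis supercrit : 1 < opnorm mu kappa one.
Hypothesis irr : quasi_irreducible mu kappa.

(** The side condition for [schur] with test function [rho]. Outside S' the intensity is 0; inside,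
    the zero set Z of [rho] is not linked to the rest of S', and irreducibility makes Z null or all
    of S' up to a null set. *)
Lemma rho_lam0 : {ae mu, forall x, rho x = 0%R -> lam x = 0%R}.
Proof.
have [S' [mS' S'0 irrS' off]] := irr.
have lam_off x : ~ S' x -> lam x = 0%R.
  move=> xS'; rewrite /Defs.lam (eq_integral (cst 0)) ?integral0// => y _.
  by rewrite off//; left.
have rho_off x : ~ S' x -> rho x = 0%R.
  by move=> /lam_off lx; apply/rho_eq0; rewrite /t (kop_lam0 _ _ Hk).
pose Z := S' `&` [set x | rho x = 0%R].
have mZ : measurable Z.
  apply: measurableI => //; rewrite -[X in measurable X]setTI.
  exact: (mrho measurableT [set 0%R]).
have ZS' : Z `<=` S' by move=> x [].
(* At a zero of [rho] also T rho is 0, so almost no kernel mass goes to types with positive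
   [rho]. *)
have Zsep : {ae (mu \x mu), forall z : S * S, Z z.1 -> (S' `\` Z) z.2 -> kappa z.1 z.2 =
    0%R}.
  pose q (z : S * S) := (\1_Z z.1)%:E * ((kappa z.1 z.2)%:E * (EFin \o rho) z.2).
  have mq : measurable_fun [set: S * S] q.
    apply: emeasurable_funM; last exact: (measurable_kernel_prod _ _ Hk).
    by apply/measurable_EFinP; apply: measurableT_comp.
  have q0 z : 0 <= q z by rewrite !mule_ge0 ?lee_fin ?(kernel_ge0 _ _ Hk).
  have : ae_eq (mu \x mu) [set: S * S] q (cst 0).
    apply/ae_eq_integral_abs => //.
    under eq_integral do rewrite gee0_abs//.
    rewrite (fubini_tonelli1 q)//.
    transitivity (\int[mu]_x (cst 0 x : \bar R)); last by rewrite integral0.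
    apply: eq_integral => x _; rewrite /fubini_F /q /= ge0_integralZl ?lee_fin//.
    - rewrite -/(kop mu kappa (EFin \o rho) x) tE indicE.
      case: (boolP (x \in Z)) => [/set_mem[_ /= /rho_eq0 ->]|_]; first by rewrite mule0.
      by rewrite mul0e.
    - exact: (kop_integrand_meas _ _ Hk).
    - by move=> y _; rewrite mule_ge0 ?lee_fin ?(kernel_ge0 _ _ Hk).
  apply: filterS => -[x y] /(_ I) /= + Zx [S'y Zy].
  rewrite /q /= indicE mem_set// mul1e -EFinM => -[/eqP];
    rewrite mulf_eq0 => /orP[/eqP //|/eqP ry].
  by exfalso; apply: Zy.
have [Z0|ZS] := irrS' Z mZ ZS' Zsep.
  exists Z; split => // x /= nH; split.
    by apply: contrapT => xS'; apply: nH => _; exact: lam_off.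
  by apply: contrapT => h; apply: nH => /h.
(* Here Z fills S', so [rho] is 0 a.e. and the norm cannot exceed 1. *)
exfalso; move: supercrit; apply/negP; rewrite -leNgt.
apply: extinct_opnorm_le1.
exists (S' `\` Z); split.
- exact: measurableD.
- rewrite measureD//; last by rewrite (le_lt_trans (probability_le1 mu mS'))// ltry.
  have -> : S' `&` Z = Z by apply/seteqP; split => x; [case|move=> Zx; split => //;
    exact: ZS'].
  transitivity (mu S' - mu S'); first by congr (_ - _); exact: ZS.
  by rewrite subee// fin_num_measure.
- move=> x /= rx; split; first by apply: contrapT => /rho_off.
  by move=> [_ /rx].
Qed.

Hypothesis hs : \int[(mu \x mu)%E]_z ((kappa z.1 z.2) ^+ 2)%:E < +oo.

(* [e] is the defect of the Schur multiplier [w T rho / rho] (junk value [1]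
   where [rho = 0]); it is positive as [w = exp (- T rho)]. *)
Let e x : R := (1 - w x * t x / rho x)%R.

Let mt : measurable_fun [set: S] t.
Proof. by apply: measurableT_comp => //; apply: kop_meas => // y; rewrite lee_fin. Qed.

Let me : measurable_fun [set: S] e.
Proof.
apply: measurable_funB => //; apply: measurable_funM; last exact: measurable_inv_ge0.
exact: measurable_funM.
Qed.

Let e_le1 x : (e x <= 1)%R.
Proof. by rewrite /e gerBl divr_ge0// mulr_ge0. Qed.

(** Strictness of 1 + t < exp(t) for nonzero t. The gap closes as t tends to 0, so this yields no
    uniform lower bound. *)
Let e_gt0 x : (0 < e x)%R.
Proof.
rewrite /e; have [->|r0] := eqVneq (rho x) 0%R; first by rewrite invr0 mulr0 subr0.
have rp : (0 < rho x)%R by rewrite lt_def r0 rho0.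
have tn0 : t x != 0%R by apply/eqP => /rho_eq0 /eqP; rewrite (negbTE r0).
rewrite subr_gt0 ltr_pdivrMr// mul1r rhoE wt.
have := expR_gt1Dx tn0; have := expR_gt0 (- t x).
move=> E1 E2; have : (expR (- t x) * (1 + t x) < expR (- t x) * expR (t x))%R by rewrite
    ltr_pM2l.
by rewrite -expRD addNr expR0; lra.
Qed.

Let e_ge0 x : (0 <= e x)%R. Proof. exact: ltW. Qed.

(* As [e > 0], dividing [kappa^2] by [den n] makes its integral vanish as [n] grows. *)
Let den (n : nat) (z : S * S) : R := (2^-1 + n%:R * (e z.1 * e z.2))%R.

Let den_gt0 n z : (0 < den n z)%R.
Proof. by rewrite ltr_pwDl ?invr_gt0// mulr_ge0// mulr_ge0. Qed.

Let mden n : measurable_fun [set: S * S] (den n).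
Proof.
by apply: measurable_funD => //; apply: measurable_funM => //; apply: measurable_funM;
  exact: measurableT_comp.
Qed.

Let mkk : measurable_fun [set: S * S] (fun z : S * S => (kappa z.1 z.2) ^+ 2)%R.
Proof. by have [_ _ mk _ _] := Hk; exact: measurable_funX. Qed.

Let hs_int n (z : S * S) : R := ((kappa z.1 z.2) ^+ 2 / den n z)%R.

Let mhs_int n : measurable_fun [set: S * S] (hs_int n).
Proof.
apply: measurable_funM => //; apply: measurable_inv_ge0 => // z; exact: ltW.
Qed.

Let hs_int_ge0 n z : (0 <= hs_int n z)%R.
Proof. by rewrite divr_ge0 ?sqr_ge0// ltW. Qed.

Lemma hs_small : exists n, \int[(mu \x mu)%E]_z (hs_int n z)%:E <= (2^-1)%:E.
Proof.
have c : \int[(mu \x mu)%E]_z (hs_int n z)%:E @[n --> \oo] -->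
    \int[(mu \x mu)%E]_z (0%R)%:E.
  (* The factor 2 in the dominating function comes from [den n >= 1/2]. *)
  apply: (ge0_dominated_cvg _ _ (mu \x mu)%E hs_int (fun=> 0%R)
    (fun z : S * S => 2 * (kappa z.1 z.2) ^+ 2)%R) => //.
  - exact: measurable_funM.
  - move=> n z; rewrite hs_int_ge0 /= /hs_int [leRHS]mulrC ler_wpM2l ?sqr_ge0//.
    rewrite -[leRHS]invrK lef_pV2 ?posrE ?invr_gt0//.
    by rewrite lerDl mulr_ge0// mulr_ge0.
  - move=> z; rewrite -[X in _ --> X](mulr0 ((kappa z.1 z.2) ^+ 2)%R).
    apply: cvgM; first exact: cvg_cst.
    apply/gtr0_cvgV0; first exact: nearW.
    apply/cvgryPge => A; near=> n.
    rewrite (@le_trans _ _ (n%:R * (e z.1 * e z.2))%R)//; last by rewrite lerDr invr_ge0.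
    rewrite -ler_pdivrMr ?mulr_gt0//.
    near: n; exact: nbhs_infty_ger.
  - under eq_integral do rewrite EFinM.
    rewrite ge0_integralZl//; last 2 first.
    + exact/measurable_EFinP.
    + by move=> z _; rewrite lee_fin sqr_ge0.
    by apply: lte_mul_pinfty => //; rewrite lee_fin.
apply: contrapT => /forallNP H.
have : (2^-1)%:E <= \int[(mu \x mu)%E]_z (0%R)%:E :> \bar R.
  apply: cvge_ge c; apply: nearW => n; have /negP := H n.
  by rewrite -ltNge => /ltW.
by rewrite integral0_eq// lee_fin leNgt invr_gt0 ltr0n.
Unshelve. all: by end_near. Qed.

(* Let [a], [b] be the masses of [w g^2], [w f^2] against the defect [e], and [B]
   the form. The Schur test gives [2 B + a + b <= 2], and AM-GM with weight
   [den n] gives [2 B <= 1 + n a b]; the two together keep [B] away from 1. *)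
Lemma dual_form_bound n (f g : S -> R) :
  \int[(mu \x mu)%E]_z (hs_int n z)%:E <= (2^-1)%:E ->
  measurable_fun [set: S] f -> (forall x, (0 <= f x)%R) ->
  measurable_fun [set: S] g -> (forall x, (0 <= g x)%R) ->
  wsq mu w (EFin \o f) <= 1 -> wsq mu w (EFin \o g) <= 1 ->
  \int[mu]_x ((w x * g x)%:E * wkop mu kappa w (EFin \o f) x) <=
    (n.+1%:R / n.+2%:R)%:E.
Proof.
move=> hsn mf f0 mg g0 f1 g1.
pose F x := (w x * f x)%R; pose G x := (w x * g x)%R.
pose al x := (w x * g x ^+ 2)%R; pose be x := (w x * f x ^+ 2)%R.
have mE (h : S -> R) : measurable_fun [set: S] h -> measurable_fun [set: S] (EFin \o h).
  by move=> /measurable_EFinP.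
have mF : measurable_fun [set: S] F by exact: measurable_funM.
have mG : measurable_fun [set: S] G by exact: measurable_funM.
have F0 x : (0 <= F x)%R by exact: mulr_ge0.
have G0 x : (0 <= G x)%R by exact: mulr_ge0.
have mal : measurable_fun [set: S] al by apply: measurable_funM => //;
  exact: measurable_funX.
have mbe : measurable_fun [set: S] be by apply: measurable_funM => //;
  exact: measurable_funX.
have al0 x : (0 <= al x)%R by rewrite mulr_ge0 ?sqr_ge0.
have be0 x : (0 <= be x)%R by rewrite mulr_ge0 ?sqr_ge0.
have al1 : \int[mu]_x (al x)%:E <= 1.
  by apply: le_trans g1; rewrite le_eqVlt; apply/orP; left; apply/eqP/eq_integral.
have be1 : \int[mu]_x (be x)%:E <= 1.
  by apply: le_trans f1; rewrite le_eqVlt; apply/orP; left; apply/eqP/eq_integral.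
set B := \int[mu]_x _.
have BE : B = \int[mu]_x ((G x)%:E * K (EFin \o F) x) by [].
have B0 : 0 <= B.
  rewrite BE; apply: integral_ge0 => x _; rewrite mule_ge0 ?lee_fin//.
  by apply: kop_ge0 => // y; rewrite lee_fin.
set a := \int[mu]_x (al x * e x)%R%:E.
set b := \int[mu]_x (be x * e x)%R%:E.
(* The Schur term for w h is the mass of w h^2 times the multiplier 1 - e, so the defect mass is
   exactly what it lacks. *)
have defect (h : S -> R) : measurable_fun [set: S] h ->
    \int[mu]_x (((w x * h x) ^+ 2 / rho x)%R%:E * K (EFin \o rho) x) +
    \int[mu]_x (w x * h x ^+ 2 * e x)%R%:E = \int[mu]_x (w x * h x ^+ 2)%R%:E.
  move=> mh; have mh2 : measurable_fun [set: S] (fun x => w x * h x ^+ 2)%R.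
    by apply: measurable_funM => //; exact: measurable_funX.
  have -> : \int[mu]_x (((w x * h x) ^+ 2 / rho x)%R%:E * K (EFin \o rho) x) =
      \int[mu]_x (w x * h x ^+ 2 * (1 - e x))%R%:E.
    apply: eq_integral => x _; rewrite tE -EFinM; congr EFin.
    by rewrite /e; ring.
  rewrite -ge0_integralD//.
  - by apply: eq_integral => x _; rewrite -EFinD; congr EFin; ring.
  - by move=> x _; rewrite lee_fin mulr_ge0 ?subr_ge0// mulr_ge0 ?sqr_ge0.
  - by apply: mE; apply: measurable_funM => //; exact: measurable_funB.
  - by move=> x _; rewrite lee_fin mulr_ge0// mulr_ge0 ?sqr_ge0.
  - by apply: mE; exact: measurable_funM.
have schurB : 2%:E * B + a + b <= 2%:E.
  have := schur _ _ Hk rho F G mrho rho0 rho_lam0 mF F0 mG G0.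
  rewrite -BE => sch.
  have := leeD sch (lexx (a + b)); rewrite addeA => /le_trans; apply.
  rewrite addeACA (defect g)// (defect f)//.
  by rewrite -[2%R]/(1 + 1)%R EFinD; apply: leeD.
have a0 : 0 <= a by apply: integral_ge0 => x _; rewrite lee_fin mulr_ge0.
have b0 : 0 <= b by apply: integral_ge0 => x _; rewrite lee_fin mulr_ge0.
have le1 (h : S -> R) : measurable_fun [set: S] h -> (forall x, (0 <= h x)%R) ->
    \int[mu]_x (h x)%:E <= 1 -> \int[mu]_x (h x * e x)%R%:E <= 1.
  move=> mh h0; apply: le_trans; apply: ge0_le_integral => //.
  - by move=> x _; rewrite lee_fin mulr_ge0.
  - by apply: mE; exact: measurable_funM.
  - exact: mE.
  - by move=> x _; rewrite lee_fin -[leRHS]mulr1 ler_wpM2l.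
have a1 : a <= 1 by exact: le1.
have b1 : b <= 1 by exact: le1.
(* Pointwise 2 kappa G F <= kappa^2 / den + den (G F)^2. The second term factorises in x and y once
   (G F)^2 is replaced by the larger al(x) be(y). *)
have hsB : 2%:E * B <= 1 + n%:R%:E * (a * b).
  pose J x := \int[mu]_y (hs_int n (x, y))%:E.
  have mJ : measurable_fun [set: S] J.
    apply: (measurable_fun_fubini_tonelli_F (fun z => (hs_int n z)%:E)).
      exact/measurable_EFinP.
    by move=> z; rewrite lee_fin.
  have J0 x : 0 <= J x by apply: integral_ge0 => y _; rewrite lee_fin.
  set b' := \int[mu]_x (be x)%:E.
  have b'0 : 0 <= b' by apply: integral_ge0 => x _; rewrite lee_fin.
  have pt x : 2%:E * ((G x)%:E * K (EFin \o F) x) <=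
      J x + ((al x / 2)%:E * b' + (n%:R * (al x * e x))%:E * b).
    rewrite muleA -kopZ//; last 2 first.
    - exact: mE.
    - by rewrite mule_ge0 ?lee_fin.
    rewrite -!ge0_integralZl//; last 6 first.
    - by apply: mE; exact: measurable_funM.
    - by move=> y _; rewrite lee_fin mulr_ge0.
    - by rewrite lee_fin mulr_ge0// mulr_ge0.
    - exact: mE.
    - by move=> y _; rewrite lee_fin.
    - by rewrite lee_fin divr_ge0.
    have mhx : measurable_fun [set: S] (fun y => hs_int n (x, y)).
      exact: measurableT_comp.
    have mbx : measurable_fun [set: S] (fun y => be y * e y)%R by exact: measurable_funM.
    rewrite -ge0_integralD//; last 4 first.
    - by move=> y _; rewrite mule_ge0 ?lee_fin ?divr_ge0.
    - by apply: measurable_funeM; exact: mE.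
    - by move=> y _; rewrite mule_ge0 ?lee_fin// !mulr_ge0.
    - by apply: measurable_funeM; exact: mE.
    rewrite -ge0_integralD//; last 4 first.
    - by move=> y _; rewrite lee_fin.
    - exact: mE.
    - by move=> y _; rewrite -!EFinM -EFinD lee_fin addr_ge0// ?mulr_ge0// ?divr_ge0//
        mulr_ge0.
    - by apply: emeasurable_funD; apply: measurable_funeM; exact: mE.
    apply: ge0_le_integral => //.
    - by move=> y _; rewrite -!EFinM lee_fin !mulr_ge0 ?(kernel_ge0 _ _ Hk).
    - apply: (kop_integrand_meas _ _ Hk); apply: measurable_funeM; exact: mE.
    - apply: emeasurable_funD; first exact: mE.
      by apply: emeasurable_funD; apply: measurable_funeM; exact: mE.
    move=> y _; rewrite /= -!EFinM -!EFinD lee_fin.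
    have -> : (al x / 2 * be y + n%:R * (al x * e x) * (be y * e y) =
        al x * be y * den n (x, y))%R by rewrite /den /=; ring.
    have D0 := den_gt0 n (x, y).
    apply: (@le_trans _ _ (hs_int n (x, y) + (G x * F y) ^+ 2 * den n (x, y))%R).
      rewrite -subr_ge0 /hs_int.
      have -> : ((kappa x y) ^+ 2 / den n (x, y) + (G x * F y) ^+ 2 * den n (x, y) -
          kappa x y * (2 * G x * F y) =
          (kappa x y - den n (x, y) * (G x * F y)) ^+ 2 / den n (x, y))%R.
        by field; rewrite gt_eqF.
      by rewrite divr_ge0 ?sqr_ge0// ltW.
    (* As w <= 1, (w g)^2 <= w g^2, and likewise for f. *)
    rewrite lerD2l ler_wpM2r ?(ltW D0)// exprMn ler_pM ?sqr_ge0//.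
    - by rewrite /G /al exprMn ler_wpM2r ?sqr_ge0// expr2 -[leRHS]mulr1 ler_wpM2l.
    - by rewrite /F /be exprMn ler_wpM2r ?sqr_ge0// expr2 -[leRHS]mulr1 ler_wpM2l.
  rewrite BE -ge0_integralZl//; last 2 first.
  - by apply: emeasurable_funM; [exact: mE|apply: kop_meas => //; exact: mE].
  - by move=> x _; rewrite mule_ge0 ?lee_fin// kop_ge0// => y; rewrite lee_fin.
  have mal2 : measurable_fun [set: S] (fun x => (al x / 2)%:E * b').
    by apply: emeasurable_funM => //; apply: mE; exact: measurable_funM.
  have male : measurable_fun [set: S] (fun x => (n%:R * (al x * e x))%:E * b).
    by apply: emeasurable_funM => //; apply: mE; apply: measurable_funM => //;
      exact: measurable_funM.
  have al20 x : 0 <= (al x / 2)%:E * b' by rewrite mule_ge0 ?lee_fin ?divr_ge0.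
  have ale0 x : 0 <= (n%:R * (al x * e x))%:E * b by rewrite mule_ge0 ?lee_fin// !mulr_ge0.
  apply: (@le_trans _ _ (\int[mu]_x (J x + ((al x / 2)%:E * b' + (n%:R * (al x * e x))%:E
      * b)))).
    apply: ge0_le_integral => //.
    - move=> x _; rewrite mule_ge0 ?lee_fin// mule_ge0 ?lee_fin//.
      by apply: kop_ge0 => // y; rewrite lee_fin.
    - apply: measurable_funeM; apply: emeasurable_funM; first exact: mE.
      by apply: kop_meas => //; exact: mE.
    - by apply: emeasurable_funD => //; exact: emeasurable_funD.
  rewrite ge0_integralD//; last 2 first.
  - by move=> x _; rewrite adde_ge0.
  - exact: emeasurable_funD.
  rewrite [X in _ + X <= _]ge0_integralD//.
  have -> : \int[mu]_x ((al x / 2)%:E * b') = (\int[mu]_x (al x / 2)%:E) * b'.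
    rewrite ge0_integralZr//; first by apply: mE; exact: measurable_funM.
    by move=> x _; rewrite lee_fin divr_ge0.
  have -> : \int[mu]_x ((n%:R * (al x * e x))%:E * b) = (\int[mu]_x (n%:R * (al x * e
      x))%:E) * b.
    rewrite ge0_integralZr//.
      by apply: mE; apply: measurable_funM => //; exact: measurable_funM.
    by move=> x _; rewrite lee_fin !mulr_ge0.
  have -> : \int[mu]_x (n%:R * (al x * e x))%R%:E = n%:R%:E * a.
    under eq_integral do rewrite EFinM.
    rewrite ge0_integralZl//; first by apply: mE; exact: measurable_funM.
    by move=> x _; rewrite lee_fin mulr_ge0.
  have -> : \int[mu]_x (al x / 2)%R%:E = (2^-1)%:E * \int[mu]_x (al x)%:E.
    under eq_integral do rewrite mulrC EFinM.
    rewrite ge0_integralZl//; first exact: mE.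
    by move=> x _; rewrite lee_fin.
  rewrite addeA -[X in _ + X <= _]muleA; apply: leeD => //.
  (* One half bounds the integral of [hs_int n]; the other is the constant term of [den n] against
     masses at most 1. *)
  have -> : 1 = (2^-1)%:E + (2^-1)%:E * (1 * 1) :> \bar R.
    by rewrite !mule1 -EFinD; congr EFin; field.
  apply: leeD; first by move: hsn; rewrite (fubini_tonelli1 (fun z => (hs_int n z)%:E))//;
    [exact/measurable_EFinP|move=> z; rewrite lee_fin].
  rewrite -muleA lee_wpmul2l ?lee_fin//; apply: lee_pmul => //.
  by apply: integral_ge0 => x _; rewrite lee_fin.
have af : a \is a fin_num by rewrite ge0_fin_numE// (le_lt_trans a1)// ltry.
have bf : b \is a fin_num by rewrite ge0_fin_numE// (le_lt_trans b1)// ltry.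
have Bf : B \is a fin_num.
  rewrite ge0_fin_numE//; case: B hsB {B0 BE schurB} => // [r|]; first by rewrite ltry.
  by rewrite -(fineK af) -(fineK bf) gt0_muley ?lte_fin// -!EFinM -EFinD leye_eq.
move: schurB hsB a0 b0 a1 b1.
rewrite -(fineK af) -(fineK bf) -(fineK Bf) -!EFinM -!EFinD !lee_fin.
move: (fine a) (fine b) (fine B) => ra rb rB sB hB ra0 rb0 ra1 rb1.
rewrite ler_pdivlMr// -[n.+2]addn2 -[n.+1]addn1 !natrD.
have n0 : (0 <= n%:R :> R)%R by [].
(* Both masses lie in [0, 1]. With a + b <= 2 - 2 B this yields 2 B <= 1 + n (1 - B), that is (n +
   2) B <= n + 1. *)
have ab : (ra * rb <= (ra + rb) / 2)%R by nra.
have : (n%:R * (ra * rb) <= n%:R * ((2 - 2 * rB) / 2))%R by rewrite ler_wpM2l//; lra.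
lra.
Qed.

Lemma dual_opnorm_lt1 : opnorm mu kappa w < 1.
Proof.
have [n hsn] := hs_small.
apply: (@le_lt_trans _ _ ((n.+1%:R / n.+2%:R)%:E)).
  apply: (opnorm_le_form _ _ Hk w mw) => // f g mf f0 mg g0 f1 g1.
  exact: dual_form_bound.
by rewrite lte_fin ltr_pdivrMr// mul1r ltr_nat.
Qed.

End Irreducible.

End Duality.

Theorem theorem3p3 (R : realType) (d : measure_display) (S : measurableType d)
  (mu : probability S R) (kappa : S -> S -> R)
  (dO : measure_display) (Om : measurableType dO)
  (P : S -> probability Om R) (X : nat -> Om -> ttree S) :
  is_kernel mu kappa ->
  is_branching_process mu kappa P X ->
  let one := fun _ : S => 1 : R in
  let w_hat := fun x : S => 1 - rho P X x in
  [/\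
  (* (i) subcritical case *)
   ((opnorm mu kappa one < 1)%E ->
     (exists g : S -> R, [/\ measurable_fun setT g,
        (wnorm2 mu one (fun x => (g x)%:E) < +oo)%E &
        {ae mu, forall x, (g x)%:E = (1 + Top mu kappa one g x)%E}]) /\
     (forall g : S -> R, measurable_fun setT g ->
        (wnorm2 mu one (fun x => (g x)%:E) < +oo)%E ->
        {ae mu, forall x, (g x)%:E = (1 + Top mu kappa one g x)%E} ->
        [/\ {ae mu, forall x, chi P X x = (g x)%:E},
            (chi_tot mu P X = \int[mu]_x (g x * one x)%:E)%E &
            (chi_tot mu P X < +oo)%E])),
  (* (ii) supercritical case *)
   ((1 < opnorm mu kappa one)%E -> (opnorm mu kappa w_hat < 1)%E ->
     (exists g : S -> R, [/\ measurable_fun setT g,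
        (wnorm2 mu w_hat (fun x => (g x)%:E) < +oo)%E &
        {ae mu, forall x, rho P X x < 1 ->
                 (g x)%:E = (1 + Top mu kappa w_hat g x)%E}]) /\
     (forall g : S -> R, measurable_fun setT g ->
        (wnorm2 mu w_hat (fun x => (g x)%:E) < +oo)%E ->
        {ae mu, forall x, rho P X x < 1 ->
                 (g x)%:E = (1 + Top mu kappa w_hat g x)%E} ->
        [/\ {ae mu, forall x, chihat P X x = (w_hat x * g x)%:E},
            (chihat_tot mu P X = \int[mu]_x (g x * one x * w_hat x)%:E)%E &
            (chihat_tot mu P X < +oo)%E]))
  &
  (* sufficient condition for the hypotheses of (ii) *)
   ((1 < opnorm mu kappa one)%E -> quasi_irreducible mu kappa ->
     (\int[(mu \x mu)%E]_z ((kappa z.1 z.2) ^+ 2)%:E < +oo)%E ->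
     (1 < opnorm mu kappa one)%E /\ (opnorm mu kappa w_hat < 1)%E)].
Proof.
move=> Hk HX one w_hat.
have m1 : measurable_fun [set: S] one by exact: measurable_cst.
have w0 x : 0 < w_hat x by exact: (extinction_gt0 mu kappa).
have w1 x : w_hat x <= 1 by exact: (extinction_le1 mu kappa).
have mw : measurable_fun [set: S] w_hat by exact: (measurable_extinction mu kappa).
(* This identifies equations a.e. for the dual measure with equations a.e. for [mu]. *)
have rho_lt1 x : rho P X x < 1 by rewrite -subr_gt0; exact: w0.
split.
- move=> op1; have [ex all] := neumann_solution mu kappa Hk one m1 (fun=> ltr01)
    (fun=> lexx 1) op1 (chi P X) (chi_resolvent mu kappa P X Hk HX).
  split=> // g mg gf Eg; have [aeE totE totoo] := all g mg gf Eg.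
  split.
  + by apply: filterS aeE => x ->; rewrite mul1r.
  + by rewrite /chi_tot totE; apply: eq_integral => x _; rewrite /one !mulr1.
  + exact: totoo.
- move=> _ op1; have [[g0 [mg0 gf0 Eg0]] all] := neumann_solution mu kappa Hk w_hat mw w0 w1
    op1 (chihat P X) (chihat_resolvent mu kappa P X Hk HX).
  split; first by exists g0; split => //; apply: filterS Eg0 => x ->.
  move=> g mg gf Eg; apply: all => //.
  by apply: filterS Eg => x; apply.
- move=> op1 irr hs; split => //.
  exact: (dual_opnorm_lt1 mu kappa P X Hk HX op1 irr hs).
Qed.
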